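(* Assume that $F$ is $\mu$-strongly convex with $\mu>0$, that $f(\cdot;\xi)$ is $L$-smooth and convex for every realization of $\xi$, and that the shared memory is consistent with a delay $\tau(t)$ that may depend on the iteration $t$. Let $w_*=\arg\min_wF(w)$ and $N=2\mathbb{E}[\|\nabla f(w_*;\xi)\|^2]$. Consider the Hogwild! general recursion $$w_{t+1}=w_t-\eta_td_{\xi_t}S^{\xi_t}_{u_t}\nabla f(\hat w_t;\xi_t),\qquad t\ge0,$$ with filter parameter $D$. Put $\ell(t)=\frac{1}{\ln t}-\frac{1}{(\ln t)^2}$. Assume that $\tau(t)$ is monotonically increasing, that $\frac{2L\alpha D}{\mu}\le\tau(t)$ for all $t$, and that $\tau(t)\le\sqrt{t\cdot\ell(t)}$ for all sufficiently large $t$. Let $\eta_t=\frac{\alpha_t}{\mu(t+2\tau(t))}$ with $12\le\alpha_t\le\alpha$. Then, as $t\to\infty$, $$\mathbb{E}[\|\hat w_{t+1}-w_*\|^2]\le\frac{4\alpha^2DN}{\mu^2}\frac1t+O\Big(\frac{1}{t\ln t}\Big),$$ and $\mathbb{E}[\|w_{t+1}-w_*\|^2]$ satisfies the same bound.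
   Context: Problem: $\xi$ is a random variable, $f(\cdot;\xi):\mathbb{R}^d\to\mathbb{R}$ is differentiable for every realization, $F(w)=\mathbb{E}[f(w;\xi)]$ and $\mathbb{E}[\nabla f(w;\xi)]=\nabla F(w)$ for every $w$. Norms are Euclidean. $\mu$-strong convexity: $F(w)-F(w')\ge\langle\nabla F(w'),w-w'\rangle+\frac{\mu}{2}\|w-w'\|^2$ for all $w,w'$. $L$-smoothness ($L>0$ uniform in $\xi$): $\|\nabla f(w;\xi)-\nabla f(w';\xi)\|\le L\|w-w'\|$ for all $w,w'$. Convexity: $f(w;\xi)-f(w';\xi)\ge\langle\nabla f(w';\xi),w-w'\rangle$ for all $w,w'$. The quantity $N$ is finite. Filters: $D_\xi\subseteq\{1,\dots,d\}$ is the set of positions $i$ for which there is some $w$ with $[\nabla f(w;\xi)]_i\neq0$; $D_\xi$ also denotes the diagonal 0/1 matrix with ones exactly at these positions, and $|D_\xi|$ the number of ones. A positive integer $D$ is fixed. For each $\xi$, non-zero diagonal 0/1 matrices $S^\xi_u$ are fixed with $\sum_uS^\xi_u=D_\xi$, each having $\lfloor|D_\xi|/D\rfloor$ or $\lceil|D_\xi|/D\rceil$ ones on its diagonal; there are $D$ of them if $D\le|D_\xi|$, and $|D_\xi|$ of them (each with a single one) if $D>|D_\xi|$. The number of matrices $S^\xi_u$ is denoted $d_\xi$. Given $\xi_t$, the index $u_t$ is chosen uniformly at random among the $d_{\xi_t}$ indices, so that $d_\xi\mathbb{E}[S^\xi_u\mid\xi]=D_\xi$. Delay: $\hat w_t$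 is the (possibly inconsistently) read vector. Shared memory is consistent with (integer-valued) delay $\tau(t)$ if for all $t$ the vector $\hat w_t$ includes all updates made up to and including the $(t-\tau(t))$-th iteration, plus some subset of the single-position updates made in later iterations up to the $t$-th; that is, $$\hat w_t=w_{t-\tau(t)}-\sum_{j=t-\tau(t)}^{t-1}\eta_jd_{\xi_j}\Sigma_{t,j}S^{\xi_j}_{u_j}\nabla f(\hat w_j;\xi_j)$$ for some (possibly random) diagonal 0/1 matrices (masks) $\Sigma_{t,j}$, where $t-\tau(t)$ is read as $\max\{t-\tau(t),0\}$. Let $\mathcal{F}_t$ be the $\sigma$-algebra generated by $w_0$ and all $\xi_j,u_j$ with $j\le t-1$ and all masks $\Sigma_{s,j}$ with $s\le t$ (so $w_t,\hat w_t$ are $\mathcal{F}_t$-measurable). The $\xi_t$ are i.i.d. copies of $\xi$, $(\xi_t,u_t)$ is independent of $\mathcal{F}_t$, $w_0$ is a given point, and $\alpha_t,\tau(t)$ are deterministic. *)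

(* Defs.v *)
From HB Require Import structures.
From mathcomp Require Import all_boot all_order all_algebra.
From mathcomp Require Import all_classical all_reals all_analysis.

Set Implicit Arguments.
Unset Strict Implicit.
Unset Printing Implicit Defensive.

Import Order.TTheory GRing.Theory Num.Theory.
Import numFieldNormedType.Exports.

Local Open Scope classical_set_scope.
Local Open Scope ring_scope.

(* Points of R^n are row vectors, so a diagonal matrix A sends v to v *m A.
   The library's norm `|v| on 'rV[R]_n is the sup norm, hence the Euclidean norm
   below. *)

Definition dotv (R : realType) (n : nat) (u v : 'rV[R]_n) : R :=
  \sum_(i < n) u 0 i * v 0 i.

Definition enorm (R : realType) (n : nat) (v : 'rV[R]_n) : R :=
  Num.sqrt (dotv v v).

(* The vector of partial derivatives; it is only used for functions that are
   assumed to be (Frechet) differentiable. *)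
Definition grad (R : realType) (n : nat) (g : 'rV[R]_n -> R) (w : 'rV[R]_n)
    : 'rV[R]_n :=
  \row_(i < n) 'D_(delta_mx 0 i) (g : 'rV[R]_n -> R^o) w.

Definition strongly_convex (R : realType) (n : nat) (mu : R)
    (g : 'rV[R]_n -> R) : Prop :=
  forall w w', dotv (grad g w') (w - w') + mu / 2 * enorm (w - w') ^+ 2
               <= g w - g w'.

Definition convex_grad (R : realType) (n : nat) (g : 'rV[R]_n -> R) : Prop :=
  forall w w', dotv (grad g w') (w - w') <= g w - g w'.

Definition smooth (R : realType) (n : nat) (L : R) (g : 'rV[R]_n -> R) : Prop :=
  forall w w', enorm (grad g w - grad g w') <= L * enorm (w - w').

Definition has_mean (d : measure_display) (Omega : measurableType d)
    (R : realType) (P : probability Omega R) (X : Omega -> R) (m : R) : Prop :=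
  P.-integrable setT (EFin \o X) /\ ('E_P[X] = m%:E)%E.

Definition diag01 (R : realType) (n : nat) (M : 'M[R]_n) : Prop :=
  is_diag_mx M /\ forall i, M i i = 0 \/ M i i = 1.

Definition nones (R : realType) (n : nat) (M : 'M[R]_n) : nat :=
  #|[pred i | M i i == 1]|.

Definition support_mx (R : realType) (n : nat) (g : 'rV[R]_n -> R) : 'M[R]_n :=
  diag_mx (\row_(i < n) (`[< exists w, grad g w 0 i <> 0 >])%:R).

Definition ceil_divn (m k : nat) : nat := ((m + k.-1) %/ k)%N.

(* The matrices S_u, 0 <= u < size Ss, that split the support matrix M into
   D parts, or into |M| single-position parts when D > |M|.  The number of
   matrices is size Ss; it is 0 exactly when M = 0. *)
Definition filters_of (R : realType) (n D : nat) (M : 'M[R]_n)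
    (Ss : seq 'M[R]_n) : Prop :=
  [/\ forall A, A \in Ss -> diag01 A /\ A <> 0,
      \sum_(A <- Ss) A = M,
      forall A, A \in Ss ->
        nones A = (nones M %/ D)%N \/ nones A = ceil_divn (nones M) D,
      (D <= nones M)%N -> size Ss = D &
      (nones M < D)%N ->
        size Ss = nones M /\ forall A, A \in Ss -> nones A = 1%N].

(* Out-of-range indices give the zero matrix. *)
Definition filter_mx (R : realType) (n : nat) (Ss : seq 'M[R]_n) (u : nat)
    : 'M[R]_n := nth 0 Ss u.

(* Conditionally on x, the index u is uniform on {0, ..., k x - 1}: on each
   event {x \in B, k x = m}, every i < m has conditional probability 1 / m.
   Where k x = 0 there is no index to choose and u is unconstrained (the filter
   is then the zero matrix). *)
Definition cond_uniform (d d' : measure_display) (Omega : measurableType d)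
    (Xi : measurableType d') (R : realType) (P : probability Omega R)
    (x : Omega -> Xi) (k : Xi -> nat) (u : Omega -> nat) : Prop :=
  forall (B : set Xi) (m i : nat), measurable B -> (i < m)%N ->
    P [set o | [/\ B (x o), k (x o) = m & u o = i]] =
    ((m%:R^-1)%:E * P [set o | B (x o) /\ k (x o) = m])%E.

Definition indep_of (d d' : measure_display) (Omega : measurableType d)
    (T : measurableType d') (R : realType) (P : probability Omega R)
    (G : set (set Omega)) (X : Omega -> T) : Prop :=
  forall (A : set Omega) (B : set T), G A -> measurable B ->
    P (A `&` X @^-1` B) = (P A * P (X @^-1` B))%E.

(* The read at iteration t uses the mask Sigma t j for t - tau t <= j < t;
   the subtraction of natural numbers is truncated at 0. *)
Definition in_window (tau : nat -> nat) (t j : nat) : bool :=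
  (t - tau t <= j < t)%N.

(* The sigma-algebra F_t generated by w_0, by x_j and u_j for j < t, and by the
   masks of the reads s <= t. *)
Definition history (d d' : measure_display) (Omega : measurableType d)
    (Xi : measurableType d') (R : realType) (n : nat) (tau : nat -> nat)
    (w0 : Omega -> 'rV[R]_n) (x : nat -> Omega -> Xi) (u : nat -> Omega -> nat)
    (Sigma : nat -> nat -> Omega -> 'M[R]_n) (t : nat) : set (set Omega) :=
  <<s (\bigcup_(i in [set: 'I_n])
         preimage_set_system setT (fun o => w0 o 0 i) measurable)
      `|` (\bigcup_(j in [set j | (j < t)%N])
         (preimage_set_system setT (x j) measurable
          `|` preimage_set_system setT (u j) measurable))
      `|` (\bigcup_(s in [set s | (s <= t)%N])
         \bigcup_(j in [set j | in_window tau s j])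
         \bigcup_(ik in [set: 'I_n * 'I_n])
           preimage_set_system setT (fun o => Sigma s j o ik.1 ik.2)
             measurable) >>.

(* Main.v *)
Require Import Defs.
From HB Require Import structures.
From mathcomp Require Import all_boot all_order all_algebra.
From mathcomp Require Import all_classical all_reals all_analysis.
From mathcomp Require Import measurable_realfun ring lra zify.
Import Order.TTheory GRing.Theory Num.Theory.
Import numFieldNormedType.Exports.
Local Open Scope classical_set_scope.
Local Open Scope ring_scope.

Set Implicit Arguments.
Unset Strict Implicit.
Unset Printing Implicit Defensive.

(* Write a_t = E|w_t - w*|^2, ah_t = E|what_t - w*|^2 and b_t = E|w_t - what_t|^2.
   Integrating over (xi_t, u_t) with the history frozen (Fubini), strong
   convexity and Young's inequality give, once eta_t is small,
     a_(t+1) <= (1 - mu eta_t / 2) a_t + K1 eta_t b_t + eta_t^2 D N,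
   while the read error is a sum of at most tau(t) recent updates, so that
     b_t <= tau(t) sum_(t - tau(t) <= j < t) eta_j^2 D (2 L^2 ah_j + N)
   and ah_t <= 2 a_t + 2 b_t.  As tau(t)^2 <= t / ln t and eta_t = O(1/t), the
   last sum is O(1/(t ln t)) as soon as ah is bounded; hence first ah is bounded
   by induction, then b_t = O(1/(t ln t)), and finally
   alpha^2 D N / (mu^2 t) + K / (t ln t) is a supersolution of the recursion. *)

(** No conditional expectation is formed. A function of the past and of the fresh pair (xi_t, u_t)
    is bounded, for each frozen past, by a function of the past alone, and the bound is integrated
    against a product law. This asks for joint measurability in a history-measurable point and a
    fresh sample, hence the Caratheodory argument. Square integrability of the iterates is not
    assumed; it is carried along an induction on t that interleaves iterates, updates and reads. The
    Lipschitz bound on grad F is taken coordinate by coordinate and costs a factor n. That factor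
    enters only K1, which multiplies the read error, so the leading constant stays free of the
    dimension. The noise carries D and not D^2 because (d S)^2 = d (d S) with d <= D, while d S
    averages to the identity on the positions where gradients live. The condition alpha_t >= 12
    yields mu eta_t / 2 >= 3 / t, and all three units of 1 / t are allotted in the last induction.
    The factor 4 of the conclusion leaves room for the passage from a to ah, which costs 2. *)

(** * Integration over fresh randomness with the past frozen *)

Section freezing.
Context (dO dZ : measure_display) (Omega : measurableType dO)
  (Z : measurableType dZ) (R : realType) (P : probability Omega R).
Variable G : set (set Omega).
Hypothesis salgG : sigma_algebra setT G.
Hypothesis subG : G `<=` measurable.

Let HT : measurableType G.-sigma := g_sigma_algebraType G.

(* The law of [o |-> (o, z o)] is the product of P restricted to G and of the law
   of z. *)
Lemma freezing (z : Omega -> Z)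
    (H : HT * Z -> \bar R)
    (b : HT -> \bar R) :
  measurable_fun setT z -> indep_of P G z ->
  measurable_fun setT H -> (forall p, 0 <= H p)%E ->
  measurable_fun setT b ->
  (forall o, \int[P]_o' H (o, z o') <= b o)%E ->
  (\int[P]_o H (o, z o) <= \int[P]_o b o)%E.
Proof.
move=> mz iz mH H0 mb Hb.
have measG (A : set Omega) :
    measurable (A : set (g_sigma_algebraType G)) <-> G A.
  by rewrite measurable_g_measurableTypeE.
have mid : measurable_fun setT (id : Omega -> g_sigma_algebraType G).
  move=> _ B mB; rewrite setTI; apply: subG; exact/measG.
pose idm : {mfun Omega >-> g_sigma_algebraType G} :=
  HB.pack (id : Omega -> g_sigma_algebraType G)
    (isMeasurableFun.Build _ _ _ _ _ mid).
pose zm : {mfun Omega >-> Z} := HB.pack z (isMeasurableFun.Build _ _ _ _ _ mz).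
have mp : measurable_fun setT
    (fun o : Omega => (o, z o) : g_sigma_algebraType G * Z).
  exact/measurable_fun_pair.
pose pm : {mfun Omega >-> (g_sigma_algebraType G * Z)%type} :=
  HB.pack (fun o : Omega => (o, z o) : g_sigma_algebraType G * Z)
    (isMeasurableFun.Build _ _ _ _ _ mp).
have -> : (\int[P]_o H (o, z o) = \int[distribution P pm]_p H p)%E.
  by rewrite ge0_integral_distribution.
have b0 o : (0 <= b o)%E.
  by apply: le_trans (Hb o); apply: integral_ge0.
have -> : (\int[P]_o b o = \int[distribution P idm]_p b p)%E.
  by rewrite ge0_integral_distribution.
have -> : (\int[distribution P pm]_p H p =
    \int[(distribution P idm \x distribution P zm)%E]_p H p)%E.
  apply: eq_measure_integral => A mA _; apply/esym.
  apply: product_measure_unique => // B C mB mC.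
  rewrite /distribution /pushforward /=.
  rewrite -iz//; exact/measG.
rewrite fubini_tonelli1//.
apply: ge0_le_integral => //.
- by move=> o _; apply: integral_ge0.
- exact: measurable_fun_fubini_tonelli_F.
move=> o _; apply: le_trans (Hb o).
rewrite /fubini_F ge0_integral_distribution//.
by apply: measurableT_comp mH _; exact: pair1_measurable.
Qed.
End freezing.

(** * Euclidean norm inequalities *)

Section euclidean.
Context (R : realType) (n : nat).
Implicit Types u v w : 'rV[R]_n.

Lemma dotv_ge0 v : 0 <= dotv v v.
Proof. by apply: sumr_ge0 => i _; rewrite -expr2 sqr_ge0. Qed.

Lemma enorm_sqr v : enorm v ^+ 2 = dotv v v.
Proof. by rewrite sqr_sqrtr// dotv_ge0. Qed.

Lemma enorm_sqr_sum v : enorm v ^+ 2 = \sum_(i < n) v 0 i ^+ 2.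
Proof. by rewrite enorm_sqr; apply: eq_bigr => i _; rewrite expr2. Qed.

Lemma enorm_ge0 v : 0 <= enorm v.
Proof. exact: sqrtr_ge0. Qed.

Lemma enormN v : enorm (- v) = enorm v.
Proof.
by congr Num.sqrt; apply: eq_bigr => i _; rewrite !mxE mulrNN.
Qed.

Lemma enorm0 : enorm (0 : 'rV[R]_n) = 0.
Proof.
by rewrite /enorm /dotv big1 ?sqrtr0// => i _; rewrite mxE mul0r.
Qed.

Lemma enormZ_sqr c v : enorm (c *: v) ^+ 2 = c ^+ 2 * enorm v ^+ 2.
Proof.
by rewrite !enorm_sqr_sum mulr_sumr; apply: eq_bigr => i _; rewrite mxE exprMn.
Qed.

Lemma norm_coord_le_enorm v i : `|v 0 i| <= enorm v.
Proof.
rewrite -(@ler_pXn2r _ 2)// ?nnegrE ?enorm_ge0// enorm_sqr_sum real_normK ?num_real//.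
by rewrite (bigD1 i)//= lerDl sumr_ge0// => j _; rewrite sqr_ge0.
Qed.

Lemma enorm_le_sum v : enorm v <= \sum_(i < n) `|v 0 i|.
Proof.
have s0 : 0 <= \sum_(i < n) `|v 0 i| by apply: sumr_ge0.
rewrite -(@ler_pXn2r _ 2)// ?nnegrE ?enorm_ge0// enorm_sqr_sum.
rewrite [leRHS]expr2 mulr_suml ler_sum// => i _.
rewrite -real_normK ?num_real// expr2 ler_wpM2l//.
by rewrite (bigD1 i)//= lerDl sumr_ge0.
Qed.

Lemma enorm_sub_sqr u v :
  enorm (u - v) ^+ 2 = enorm u ^+ 2 - 2 * dotv v u + enorm v ^+ 2.
Proof.
rewrite !enorm_sqr_sum /dotv mulr_sumr -sumrB -big_split/=.
by apply: eq_bigr => i _; rewrite !mxE; ring.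
Qed.

Lemma enormD_sqr_le u v :
  enorm (u + v) ^+ 2 <= 2 * enorm u ^+ 2 + 2 * enorm v ^+ 2.
Proof.
rewrite !enorm_sqr_sum !mulr_sumr -big_split/= ler_sum// => i _.
by rewrite mxE; have := sqr_ge0 (u 0 i - v 0 i); lra.
Qed.

(** Completing the square: the difference of the two sides is e^-1 |e u + v|^2. *)
Lemma dotv_young (e : R) u v : 0 < e ->
  - (2 * dotv u v) <= e * enorm u ^+ 2 + e^-1 * enorm v ^+ 2.
Proof.
move=> e0; rewrite !enorm_sqr_sum /dotv !mulr_sumr -sumrN -big_split/=.
apply: ler_sum => i _.
have -> : e * u 0 i ^+ 2 + e^-1 * v 0 i ^+ 2 =
    e^-1 * (e * u 0 i + v 0 i) ^+ 2 - 2 * (u 0 i * v 0 i).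
  by field; rewrite gt_eqF.
by rewrite lerDr mulr_ge0 ?sqr_ge0// invr_ge0 ltW.
Qed.

(** Cauchy-Schwarz against the constant weight 1, by induction. With k terms summed to S, Young with
    weight 1 / k turns |F x + S|^2 into at most (1 + k) |F x|^2 + (1 + 1 / k) |S|^2, and the
    induction hypothesis bounds |S|^2 by k T. The case k = 0 is apart because of the division. *)
Lemma enorm_sum_sqr_le (I : Type) (s : seq I) (F : I -> 'rV[R]_n) :
  enorm (\sum_(j <- s) F j) ^+ 2 <= (size s)%:R * \sum_(j <- s) enorm (F j) ^+ 2.
Proof.
elim: s => [|x s IH]; first by rewrite !big_nil enorm0 expr0n mulr0.
rewrite !big_cons; set S := \sum_(j <- s) F j in IH *.
set T := \sum_(j <- s) _ in IH *.
have T0 : 0 <= T by apply: sumr_ge0 => j _; rewrite sqr_ge0.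
have [s0|s0] := eqVneq (size s) 0%N.
  have -> : S = 0 by rewrite /S (size0nil s0) big_nil.
  by rewrite addr0/= s0 mul1r lerDl.
have k0 : 0 < (size s)%:R :> R by rewrite ltr0n lt0n.
set k : R := (size s)%:R in IH k0 *.
have -> : F x + S = F x - (- S) by rewrite opprK.
rewrite enorm_sub_sqr enormN.
have y : - (2 * dotv (- S) (F x)) <= k^-1 * enorm S ^+ 2 + k * enorm (F x) ^+ 2.
  by have := @dotv_young k^-1 (- S) (F x); rewrite enormN invrK invr_gt0; exact.
have IH' : k^-1 * enorm S ^+ 2 <= T by rewrite mulrC ler_pdivrMr// mulrC.
rewrite /= -natr1 -/k; lra.
Qed.

End euclidean.

(** * Joint measurability of functions of a point and a sample *)

Section joint_measurability.
Context (dT dX : measure_display) (T : measurableType dT)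
  (X : measurableType dX) (R : realType) (n : nat).

(** Preimages are countable unions of measurable rectangles, one for each value of [N]. *)
Lemma measurable_fun_countably_valued (J : countType)
    (g : X -> J -> R) (N : T -> J) :
  (forall j, measurable_fun setT (g ^~ j)) ->
  (forall j, measurable (N @^-1` [set j])) ->
  measurable_fun setT (fun p : T * X => g p.2 (N p.1)).
Proof.
move=> mg mN _ B mB; rewrite setTI.
rewrite (_ : _ @^-1` B = \bigcup_j (N @^-1` [set j] `*` (g ^~ j) @^-1` B)).
  apply: countable_bigcupT_measurable => [|j]; first exact: countableP.
  by apply: measurableX => //; rewrite -[X in measurable X]setTI; exact: mg.
apply/seteqP; split => [[t x] /= gB|[t x] [j _ [/= <-]]//].
by exists (N t).
Qed.

(* Rounding v to a grid of mesh 1/(k+1) makes it countably valued. *)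
Lemma measurable_fun_caratheodory (phi : X -> 'rV[R]_n -> R)
    (v : T -> 'rV[R]_n) (C : R) :
  (forall w, measurable_fun setT (phi ^~ w)) ->
  (forall x w w', `|phi x w - phi x w'| <= C * enorm (w - w')) ->
  (forall i, measurable_fun setT (fun t => v t 0 i)) ->
  measurable_fun setT (fun p : T * X => phi p.2 (v p.1)).
Proof.
move=> mphi lip mv.
pose grid k (z : 'rV[int]_n) : 'rV[R]_n := \row_i ((z 0 i)%:~R / k.+1%:R).
pose N k (t : T) : 'rV[int]_n := \row_i Num.floor (k.+1%:R * v t 0 i).
have mN k z : measurable (N k @^-1` [set z]).
  rewrite (_ : _ @^-1` _ = \bigcap_(i in [set: 'I_n])
      ((fun t => k.+1%:R * v t 0 i) @^-1` `[(z 0 i)%:~R, (z 0 i + 1)%:~R[)).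
    apply: fin_bigcap_measurable => [|i _]; first exact: finite_finset.
    rewrite -[X in measurable X]setTI.
    by apply: measurable_funM => //; exact: measurable_itv.
  apply/seteqP; split => [t <- i _|t zt] /=.
    by rewrite in_itv/= mxE floor_itv.
  apply/rowP => i; rewrite mxE; apply/eqP; rewrite floor_eq.
  by have := zt i I; rewrite /= in_itv.
apply: (@measurable_fun_cvg _ _ _ _
    (fun k p => phi p.2 (grid k (N k p.1)))) => [k|[t x] _ /=].
  by apply: (@measurable_fun_countably_valued _
       (fun x z => phi x (grid k z)) (N k)).
(* Each of the n coordinates moves by at most 1 / (k + 1), and the Euclidean norm is at most the sum
   of the coordinates. The sign of [C] is not known, hence its absolute value. *)
have bnd k : `|phi x (v t) - phi x (grid k (N k t))| <= (`|C| * n%:R) * k.+1%:R^-1.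
  apply: (le_trans (lip _ _ _)).
  apply: (@le_trans _ _ (`|C| * enorm (v t - grid k (N k t)))).
    by rewrite ler_wpM2r ?enorm_ge0// ler_norm.
  rewrite -mulrA ler_wpM2l//; apply: (le_trans (enorm_le_sum _)).
  rewrite -[n%:R]mul1r mulrAC mulr_natr -[X in _ *+ X](card_ord n) -sumr_const.
  apply: ler_sum => i _; rewrite !mxE mul1r.
  have k0 : 0 < k.+1%:R :> R by [].
  have -> : v t 0 i - (Num.floor (k.+1%:R * v t 0 i))%:~R / k.+1%:R =
     (k.+1%:R * v t 0 i - (Num.floor (k.+1%:R * v t 0 i))%:~R) / k.+1%:R.
    by field; rewrite gt_eqF.
  rewrite normrM [X in _ * X]ger0_norm ?invr_ge0// ler_piMl ?invr_ge0//.
  have /andP[h1] := floor_itv (k.+1%:R * v t 0 i).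
  rewrite intrD => h2; rewrite ger0_norm ?subr_ge0// lerBlDl; exact: ltW.
apply/cvgrPdist_le => e e0.
have [C0|Cn] := eqVneq (`|C| * n%:R) 0.
  by apply: nearW => k; apply: (le_trans (bnd k)); rewrite C0 mul0r ltW.
have Cp : 0 < `|C| * n%:R by rewrite lt_neqAle eq_sym Cn/= mulr_ge0.
have eC : 0 < e / (`|C| * n%:R) by rewrite divr_gt0.
have := near_infty_natSinv_lt (PosNum eC); apply: filterS => k /= hk.
apply: (le_trans (bnd k)).
by rewrite -ler_pdivlMl// mulrC ltW.
Qed.

End joint_measurability.

(** * Measurability of gradients in the sample *)

Section measurable_grad.
Context (dX : measure_display) (X : measurableType dX) (R : realType) (n : nat).

(** A partial derivative is the pointwise limit of the difference quotients with steps 1 / (k + 1),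
    which are measurable in the sample. *)
Lemma measurable_fun_grad (f : X -> 'rV[R]_n -> R) (w : 'rV[R]_n) (i : 'I_n) :
  (forall v, measurable_fun setT (fun x => f x v)) ->
  (forall x, differentiable (f x : 'rV[R]_n -> R^o) w) ->
  measurable_fun setT (fun x => grad (f x) w 0 i).
Proof.
move=> mf df; set e := delta_mx 0 i : 'rV[R]_n.
pose h k : R := k.+1%:R^-1.
apply: (@measurable_fun_cvg _ _ _ _
    (fun k x => (h k)^-1 * (f x (h k *: e + w) - f x w))) => [k|x _].
  by apply: measurable_funM => //; exact: measurable_funB.
rewrite mxE.
have dx := @diff_derivable _ _ _ _ _ e (df x).
have hcvg : h k @[k --> \oo] --> 0^'.
  move=> A /= [eps /= e0 epsA].
  have := near_infty_natSinv_lt (PosNum e0); apply: filterS => k /= hk.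
  apply: epsA => /=; first by rewrite sub0r normrN ger0_norm// invr_ge0.
  by rewrite /h invr_neq0.
apply: (@cvg_comp _ _ _ h
  (fun z : R => z^-1 *: (f x (z *: e + w) - f x w : R^o)) _ (0^') _ hcvg).
exact: dx.
Qed.
End measurable_grad.

(** * Averaging over a conditionally uniform index *)

Section uniform_index.
Local Open Scope ereal_scope.
Context (dO dX : measure_display) (Omega : measurableType dO)
  (Xi : measurableType dX) (R : realType) (P : probability Omega R).
Variables (x : {RV P >-> Xi}) (u : {RV P >-> nat}) (k : Xi -> nat).
Hypotheses (mk : measurable_fun setT k) (x_u : cond_uniform P x k u).
Variable H : Xi * nat -> \bar R.
Hypotheses (mH : measurable_fun setT H) (H0 : forall p, 0 <= H p).

Let mkx m : measurable [set o | k (x o) = m].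
Proof.
have mkx : measurable_fun setT (k \o x) by exact: measurableT_comp.
by rewrite -[X in measurable X]setTI; exact: (mkx measurableT [set m]).
Qed.

Let mui i : measurable [set o | u o = i].
Proof.
have mu : measurable_fun setT u by exact: measurable_funP.
by rewrite -[X in measurable X]setTI; exact: (mu measurableT [set i]).
Qed.

Let mHu : measurable_fun setT (fun o => H (x o, u o)).
Proof. by apply: measurableT_comp => //; exact: measurable_fun_pair. Qed.

Let mHi i : measurable_fun setT (fun o => H (x o, i)).
Proof. by apply: measurableT_comp => //; exact: measurable_fun_pair. Qed.

(** On the set of pairs (y, i) with k y = m, [cond_uniform] says that the law of (x, u) is 1 / m
    times the law of (x, i). Both integrals are pushed forward to that set. *)
Lemma integral_cond_uniform_slice m i : (i < m)%N ->
  \int[P]_(o in [set o | k (x o) = m] `&` [set o | u o = i]) H (x o, u o) =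
  (m%:R^-1)%:E * \int[P]_(o in [set o | k (x o) = m]) H (x o, i).
Proof.
move=> im.
have mp : measurable_fun setT (fun o => (x o, u o)) by exact: measurable_fun_pair.
have mq : measurable_fun setT (fun o => (x o, i)) by exact: measurable_fun_pair.
pose p : {mfun Omega >-> (Xi * nat)%type} :=
  HB.pack (fun o => (x o, u o)) (isMeasurableFun.Build _ _ _ _ _ mp).
pose q : {mfun Omega >-> (Xi * nat)%type} :=
  HB.pack (fun o => (x o, i)) (isMeasurableFun.Build _ _ _ _ _ mq).
pose A := (k @^-1` [set m]) `*` [set i].
have mA : measurable A.
  by apply: measurableX => //; rewrite -[X in measurable X]setTI; exact: mk.
have H0A : {in A, forall z, 0 <= H z} by [].
have mHA : measurable_fun A H by exact: measurable_funS mH.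
have -> : [set o | k (x o) = m] `&` [set o | u o = i] = p @^-1` A by [].
have -> : [set o | k (x o) = m] = q @^-1` A.
  by apply/seteqP; split => [y ky | y []].
transitivity (\int[distribution P p]_(z in A) H z).
  by rewrite ge0_integral_pushforward.
transitivity (m%:R^-1%:E * \int[distribution P q]_(z in A) H z); last first.
  by rewrite ge0_integral_pushforward.
have minv0 : (0 <= m%:R^-1 :> R)%R by rewrite invr_ge0.
rewrite -(ge0_integral_mscale _ mA (NngNum minv0))//.
apply: eq_measure_integral => B mB BA.
pose B1 := (fun y => (y, i)) @^-1` B.
have mB1 : measurable B1.
  have mi : measurable_fun setT (fun y : Xi => (y, i)).
    exact: measurable_fun_pair.
  by rewrite -[X in measurable X]setTI; exact: mi.
have BE (y : Xi) (j : nat) : B (y, j) <-> [/\ B1 y, k y = m & j = i].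
  split => [yj|[? _ ->]//].
  have [/= ky ji] := BA _ yj; split => //.
  by rewrite /B1/= -ji.
rewrite /distribution /mscale/= /pushforward.
transitivity (P [set o | [/\ B1 (x o), k (x o) = m & u o = i]]).
  by congr (P _); apply/seteqP; split => o /= /BE.
rewrite x_u//; congr (_ * P _).
apply/seteqP; split => [y /= [Bx kx]|y /= /BE[? ? _]//].
exact/BE.
Qed.

(** Omega is cut into the cells k x = m, u = i, finitely many of them relevant since k <= D; on each
    the factor m cancels the probability 1 / m. Vanishing of [H] beyond k disposes of out-of-range
    indices: a null event if k > 0, an unconstrained [u] if k = 0. *)
Lemma integral_cond_uniform (D : nat) :
  (forall y, (k y <= D)%N) -> (forall y i, (k y <= i)%N -> H (y, i) = 0) ->
  \int[P]_o ((k (x o))%:R%:E * H (x o, u o)) =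
  \int[P]_o \sum_(i < k (x o)) H (x o, i : nat).
Proof.
move=> kD Hk.
pose E m i := [set o | k (x o) = m] `&` [set o | u o = i].
have mE m i : measurable (E m i) by exact: measurableI.
pose f m i := (fun o => m%:R%:E * H (x o, u o)) \_ (E m i).
pose g m i := (fun o => H (x o, i)) \_ [set o | k (x o) = m].
have f0 m i o : 0 <= f m i o.
  by rewrite /f patchE; case: ifP => // _; rewrite mule_ge0.
have g0 m i o : 0 <= g m i o by rewrite /g patchE; case: ifP.
have mf m i : measurable_fun setT (f m i).
  apply/(measurable_restrictT _ _).1 => //; apply: measurable_funTS.
  exact: measurable_funeM.
have mg m i : measurable_fun setT (g m i).
  by apply/(measurable_restrictT _ _).1 => //; apply: measurable_funTS.
transitivity (\int[P]_o \sum_(m < D.+1) \sum_(i < m) f m i o).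
  apply: eq_integral => o _.
  have kxD : (k (x o) < D.+1)%N by rewrite ltnS.
  rewrite (bigD1 (Ordinal kxD))//= [X in _ + X]big1 ?adde0; last first.
    move=> m /eqP mk'; apply: big1 => i _.
    rewrite /f patchE memNset// => -[/= kx _]; apply: mk'.
    by apply: val_inj => /=.
  have [ux|ux] := ltnP (u o) (k (x o)).
    rewrite (bigD1 (Ordinal ux))//= big1 ?adde0; last first.
      move=> i /eqP iu; rewrite /f patchE memNset// => -[/= _ uo]; apply: iu.
      by apply: val_inj => /=.
    by rewrite /f patchE mem_set.
  rewrite Hk// mule0 big1// => i _; rewrite /f patchE; case: ifP => // _.
  by rewrite Hk// mule0.
transitivity (\int[P]_o \sum_(m < D.+1) \sum_(i < m) g m i o); last first.
  apply: eq_integral => o _.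
  have kxD : (k (x o) < D.+1)%N by rewrite ltnS.
  rewrite (bigD1 (Ordinal kxD))//= [X in _ + X]big1 ?adde0; last first.
    move=> m /eqP mk'; apply: big1 => i _.
    rewrite /g patchE memNset// => /= kx; apply: mk'.
    by apply: val_inj => /=.
  by apply: eq_bigr => i _; rewrite /g patchE mem_set.
have mfs m : measurable_fun setT (fun o => \sum_(i < m) f m i o).
  exact: emeasurable_sum.
have mgs m : measurable_fun setT (fun o => \sum_(i < m) g m i o).
  exact: emeasurable_sum.
rewrite !ge0_integral_sum//; try by move=> *; apply: sume_ge0.
apply: eq_bigr => m _; rewrite !ge0_integral_sum//; apply: eq_bigr => i _.
rewrite /f /g -!integral_mkcond.
rewrite ge0_integralZl_EFin//; last exact: measurable_funTS.
rewrite integral_cond_uniform_slice// muleA -EFinM divff ?mul1e//.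
by rewrite pnatr_eq0 -lt0n (leq_ltn_trans _ (ltn_ord i)).
Qed.

End uniform_index.

(** * Calculus of finite means *)

Section has_mean_theory.
Context (d : measure_display) (Omega : measurableType d) (R : realType)
  (P : probability Omega R).
Implicit Types X Y : Omega -> R.

Lemma has_meanE X m : has_mean P X m <->
  P.-integrable setT (EFin \o X) /\ (\int[P]_o (X o)%:E = m%:E)%E.
Proof. by split=> -[iX Xm]; split=> //; move: Xm; rewrite unlock. Qed.

Lemma has_mean_measurable X m : has_mean P X m -> measurable_fun setT X.
Proof. by move=> [/integrableP[/measurable_EFinP]]. Qed.

Lemma has_mean_uniq X a b : has_mean P X a -> has_mean P X b -> a = b.
Proof. by move=> [_ Xa] [_]; rewrite Xa => -[]. Qed.

Lemma eq_has_mean X Y m : X =1 Y -> has_mean P X m -> has_mean P Y m.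
Proof. by move=> /funext ->. Qed.

Lemma integrable_has_mean X : P.-integrable setT (EFin \o X) ->
  has_mean P X (fine (\int[P]_o (X o)%:E)).
Proof.
by move=> iX; apply/has_meanE; split=> //; rewrite fineK// integral_fune_fin_num.
Qed.

Lemma has_mean_cst c : has_mean P (fun=> c) c.
Proof.
apply/has_meanE; split; last by rewrite integral_cst//= probability_setT mule1.
by apply: finite_measure_integrable_cst.
Qed.

Lemma has_meanD X Y a b : has_mean P X a -> has_mean P Y b ->
  has_mean P (fun o => X o + Y o) (a + b).
Proof.
move=> /has_meanE[iX Xa] /has_meanE[iY Yb]; apply/has_meanE; split.
  by have := integrableD measurableT iX iY.
by under eq_integral do rewrite EFinD; rewrite integralD// Xa Yb.
Qed.

Lemma has_meanZ X a c : has_mean P X a ->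
  has_mean P (fun o => c * X o) (c * a).
Proof.
move=> /has_meanE[iX Xa]; apply/has_meanE; split.
  by have := integrableZl measurableT c iX.
by under eq_integral do rewrite EFinM; rewrite integralZl// Xa.
Qed.

Lemma has_meanB X Y a b : has_mean P X a -> has_mean P Y b ->
  has_mean P (fun o => X o - Y o) (a - b).
Proof.
move=> Xa /(has_meanZ (-1)) Yb; have := has_meanD Xa Yb; rewrite mulN1r.
by apply: eq_has_mean => o; rewrite mulN1r.
Qed.

Lemma has_mean_sum (I : eqType) (s : seq I) (F : I -> Omega -> R) (a : I -> R) :
  (forall i, i \in s -> has_mean P (F i) (a i)) ->
  has_mean P (fun o => \sum_(i <- s) F i o) (\sum_(i <- s) a i).
Proof.
elim: s => [|i s IH] Fa.
  rewrite big_nil; apply: eq_has_mean (has_mean_cst 0) => o.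
  by rewrite big_nil.
have Fi : has_mean P (F i) (a i) by apply: Fa; rewrite mem_head.
have Fs : has_mean P (fun o => \sum_(j <- s) F j o) (\sum_(j <- s) a j).
  by apply: IH => j js; apply: Fa; rewrite inE js orbT.
rewrite big_cons; apply: eq_has_mean (has_meanD Fi Fs) => o.
by rewrite big_cons.
Qed.

Lemma has_mean_le X Y a b : has_mean P X a -> has_mean P Y b ->
  (forall o, X o <= Y o) -> a <= b.
Proof.
move=> /has_meanE[iX Xa] /has_meanE[iY Yb] XY.
by rewrite -lee_fin -Xa -Yb; apply: le_integral => // o _; rewrite lee_fin.
Qed.

Lemma has_mean_dominated X Y b : measurable_fun setT X ->
  (forall o, 0 <= X o <= Y o) -> has_mean P Y b ->
  has_mean P X (fine (\int[P]_o (X o)%:E)).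
Proof.
move=> mX XY /has_meanE[iY _]; apply: integrable_has_mean.
apply: le_integrable iY => //; first exact/measurable_EFinP.
move=> o _ /=; have /andP[X0 XYo] := XY o.
by rewrite lee_fin !ger0_norm// (le_trans X0).
Qed.

Lemma ge0_has_mean_le X m : measurable_fun setT X -> (forall o, 0 <= X o) ->
  (\int[P]_o (X o)%:E <= m%:E)%E ->
  has_mean P X (fine (\int[P]_o (X o)%:E)) /\ fine (\int[P]_o (X o)%:E) <= m.
Proof.
move=> mX X0 Xm.
have iX : P.-integrable setT (EFin \o X).
  apply/integrableP; split; first exact/measurable_EFinP.
  under eq_integral do rewrite gee0_abs ?lee_fin//.
  exact: le_lt_trans Xm (ltry _).
split; first exact: integrable_has_mean.
by rewrite -lee_fin fineK// integral_fune_fin_num.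
Qed.

Lemma ge0_has_mean X m : measurable_fun setT X -> (forall o, 0 <= X o) ->
  (\int[P]_o (X o)%:E = m%:E)%E -> has_mean P X m.
Proof.
move=> mX X0 Xm; apply/has_meanE; split => //; apply/integrableP; split.
  exact/measurable_EFinP.
under eq_integral do rewrite gee0_abs ?lee_fin//.
by rewrite Xm ltry.
Qed.

(** The middle term is kept as m a so that summation over coordinates produces
    [dotv (grad F w) y]. *)
Lemma has_mean_affine_sqr X m q a e :
  has_mean P X m -> has_mean P (fun o => X o ^+ 2) q ->
  has_mean P (fun o => (a - e * X o) ^+ 2)
    (a ^+ 2 - 2 * e * (m * a) + e ^+ 2 * q).
Proof.
move=> Xm Xq.
have := has_meanD (has_meanB (has_mean_cst (a ^+ 2)) (has_meanZ (2 * e * a) Xm))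
  (has_meanZ (e ^+ 2) Xq).
rewrite [X in has_mean _ _ X -> _](_ : _ = a ^+ 2 - 2 * e * (m * a) + e ^+ 2 * q).
  by apply: eq_has_mean => o; ring.
by ring.
Qed.

End has_mean_theory.

(** * Transfer of means between variables of equal law *)

Section law_transfer.
Context (d dX : measure_display) (Omega : measurableType d)
  (Xi : measurableType dX) (R : realType) (P : probability Omega R).
Variables x y : {RV P >-> Xi}.
Hypothesis same_law : forall B : set Xi, measurable B ->
  P (x @^-1` B) = P (y @^-1` B).

Lemma has_mean_same_law (phi : Xi -> R) m : measurable_fun setT phi ->
  has_mean P (phi \o y) m -> has_mean P (phi \o x) m.
Proof.
move=> mphi /has_meanE[iy ym]; have mE : measurable_fun setT (EFin \o phi).
  exact/measurable_EFinP.
have lawE (g : Xi -> \bar R) :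
    (\int[distribution P x]_z g z = \int[distribution P y]_z g z)%E.
  by apply: eq_measure_integral => B mB _; exact: same_law.
have mabs : measurable_fun setT (fun z => `|(phi z)%:E|%E).
  exact: measurableT_comp.
have absE (z : {RV P >-> Xi}) :
    (\int[P]_o `|(phi (z o))%:E| = \int[distribution P z]_w `|(phi w)%:E|)%E.
  by rewrite ge0_integral_distribution.
have ix : P.-integrable setT (EFin \o (phi \o x)).
  apply/integrableP; split.
    exact: measurableT_comp mE (measurable_funP x).
  by move: iy => /integrableP[_]; rewrite /= !absE lawE.
apply/has_meanE; split => //.
have /(_ mE ix) := @integral_distribution _ _ _ _ _ P x (EFin \o phi).
have /(_ mE iy) := @integral_distribution _ _ _ _ _ P y (EFin \o phi).
by rewrite lawE => -> <-.
Qed.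
End law_transfer.

(** * Algebra of the filter matrices *)

Section filters.
Context (R : realType) (n D : nat).
Implicit Types (A M : 'M[R]_n) (Ss : seq 'M[R]_n) (g : 'rV[R]_n).

Lemma mul_diag01 g A i : diag01 A -> (g *m A) 0 i = g 0 i * A i i.
Proof.
move=> [/is_diag_mxP dA _]; rewrite mxE (bigD1 i)//= big1 ?addr0// => j ji.
by rewrite dA// mulr0.
Qed.

Lemma filter_mx_diag01 M Ss u : filters_of D M Ss -> diag01 (filter_mx Ss u).
Proof.
move=> [SsA _ _ _ _]; have [us|us] := ltnP u (size Ss).
  by have [] := SsA _ (mem_nth 0 us).
rewrite /filter_mx nth_default//; split; last by move=> i; left; rewrite mxE.
by apply/is_diag_mxP => i j _; rewrite mxE.
Qed.

Lemma filters_size_le M Ss : (0 < D)%N -> filters_of D M Ss -> (size Ss <= D)%N.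
Proof.
move=> D0 [_ _ _ big small]; have [h|h] := leqP D (nones M); first by rewrite big.
by have [-> _] := small h; exact: ltnW.
Qed.

Lemma sum_filter_mx M Ss i : filters_of D M Ss ->
  \sum_(u < size Ss) filter_mx Ss u i i = M i i.
Proof.
by move=> [_ <- _ _ _]; rewrite summxE (big_nth 0) big_mkord.
Qed.

(** Filters are non-zero and out-of-range indices give zero, so the number of filters can be read
    off the matrix entries. The measurability of d_xi comes from this. *)
Lemma filter_mx_eq0 M Ss u : filters_of D M Ss ->
  (filter_mx Ss u == 0) = (size Ss <= u)%N.
Proof.
move=> [SsA _ _ _ _]; have [us|us] := ltnP u (size Ss); last first.
  by rewrite /filter_mx nth_default// eqxx.
by have [_ /eqP/negPf] := SsA _ (mem_nth 0 us).
Qed.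

Lemma grad_support (f : 'rV[R]_n -> R) w i :
  support_mx f i i * grad f w 0 i = grad f w 0 i.
Proof.
rewrite !mxE eqxx; case: asboolP => /= [_|nex]; first by rewrite mul1r.
by rewrite mul0r; apply: contra_notP nex => /nesym w0; exists w; rewrite mxE.
Qed.
End filters.

(** * Means of filtered coordinates *)

Section filtered_moments.
Context (dO dX : measure_display) (Omega : measurableType dO)
  (Xi : measurableType dX) (R : realType) (n : nat) (P : probability Omega R).
Variables (f : Xi -> 'rV[R]_n -> R) (D : nat) (Ss : Xi -> seq 'M[R]_n).
Hypotheses (D_gt0 : (0 < D)%N)
  (Ss_filters : forall x, filters_of D (support_mx (f x)) (Ss x))
  (Ss_meas : forall u i k,
    measurable_fun setT (fun x => filter_mx (Ss x) u i k)).

Lemma measurable_fun_filters_size : measurable_fun setT (fun x => size (Ss x)).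
Proof.
have mle u : measurable [set x | (size (Ss x) <= u)%N].
  rewrite (_ : [set _ | _] = \bigcap_(ik in [set: 'I_n * 'I_n])
      ((fun x => filter_mx (Ss x) u ik.1 ik.2) @^-1` [set 0])).
    apply: fin_bigcap_measurable => [|ik _]; first exact: finite_finset.
    by rewrite -[X in measurable X]setTI; exact: Ss_meas.
  apply/seteqP; split => x /=.
    by rewrite -(filter_mx_eq0 u (Ss_filters x)) => /eqP S0 ik _ /=; rewrite S0 mxE.
  move=> S0; rewrite -(filter_mx_eq0 u (Ss_filters x)); apply/eqP/matrixP => i k.
  by rewrite mxE; exact: (S0 (i, k) I).
move=> _ B mB; rewrite setTI.
rewrite (_ : _ @^-1` B = \bigcup_(m in B)
    ([set x | (size (Ss x) <= m)%N] `\`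
     \bigcup_(j in [set j | (j < m)%N]) [set x | (size (Ss x) <= j)%N])).
  apply: bigcup_measurable => m _; apply: measurableD => //.
  exact: bigcup_measurable.
apply/seteqP; split => [x /= Bx|x [m Bm [/= xm xn]]].
  by exists (size (Ss x)) => //; split => //= -[j /= xj]; rewrite leqNgt xj.
rewrite /= (_ : size (Ss x) = m)//; apply/eqP; rewrite eqn_leq xm leqNgt.
by apply/negP => sm; apply: xn; exists (size (Ss x)) => /=.
Qed.

Variables (x : {RV P >-> Xi}) (u : {RV P >-> nat}).
Hypothesis x_u : cond_uniform P x (fun y => size (Ss y)) u.

Let kS i o : R := (size (Ss (x o)))%:R * filter_mx (Ss (x o)) (u o) i i.

Lemma measurable_fun_joint_filter i j : measurable_fun setT
  (fun p : Xi * nat => filter_mx (Ss p.1) p.2 i j).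
Proof.
have := @measurable_fun_countably_valued _ _ nat Xi R nat
  (fun y u => filter_mx (Ss y) u i j) id.
move=> /(_ (fun u => Ss_meas u i j) (fun=> I)) m.
by have := measurableT_comp m (@measurable_swap _ _ Xi nat).
Qed.

Lemma measurable_fun_size_natr : measurable_fun setT
  (fun y => (size (Ss y))%:R : R).
Proof.
apply: (measurableT_comp (f := fun m : nat => m%:R : R)) => //.
exact: measurable_fun_filters_size.
Qed.

Lemma measurable_fun_kS i : measurable_fun setT (kS i).
Proof.
apply: measurable_funM; first exact: measurableT_comp measurable_fun_size_natr _.
apply: (measurableT_comp (measurable_fun_joint_filter i i)
  (g := fun o => (x o, u o))).
exact: measurable_fun_pair.
Qed.

(** Averaging d S_u over u gives the support matrix, which fixes [phi]. Nonnegativity lets the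
    averaging identity be used before integrability of the filtered variable is known. *)
Lemma has_mean_filtered_ge0 i (phi : Xi -> R) m : measurable_fun setT phi ->
  (forall y, 0 <= phi y) -> (forall y, support_mx (f y) i i * phi y = phi y) ->
  has_mean P (phi \o x) m -> has_mean P (fun o => kS i o * phi (x o)) m.
Proof.
move=> mphi phi0 phiS /has_meanE[_ phim].
have S01 y j : 0 <= filter_mx (Ss y) j i i.
  by have [_ /(_ i)[->|->]] := filter_mx_diag01 j (Ss_filters y).
apply: ge0_has_mean => [|o|].
- apply: measurable_funM; first exact: measurable_fun_kS.
  exact: measurableT_comp mphi _.
- by rewrite !mulr_ge0.
pose H (p : Xi * nat) : \bar R := (filter_mx (Ss p.1) p.2 i i * phi p.1)%:E.
rewrite -phim; transitivity (\int[P]_o ((size (Ss (x o)))%:R%:E * H (x o, u o)))%E.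
  by apply: eq_integral => o _; rewrite -EFinM mulrA.
rewrite (@integral_cond_uniform _ _ _ _ _ _ _ _ _ measurable_fun_filters_size x_u H _ _ D).
- apply: eq_integral => o _; rewrite /H/= sumEFin -mulr_suml.
  by rewrite (sum_filter_mx _ (Ss_filters _)) phiS.
- apply/measurable_EFinP; apply: measurable_funM.
    exact: measurable_fun_joint_filter.
  exact: measurableT_comp mphi _.
- by move=> p; rewrite lee_fin mulr_ge0.
- by move=> y; exact: filters_size_le (Ss_filters y).
- by move=> y j sj; rewrite /H/= /filter_mx nth_default// mxE mul0r.
Qed.

(** Reduction to the nonnegative case: the positive and negative parts of [phi] are dominated by its
    absolute value and inherit the support condition. *)
Lemma has_mean_filtered i (phi : Xi -> R) m : measurable_fun setT phi ->
  (forall y, support_mx (f y) i i * phi y = phi y) ->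
  has_mean P (phi \o x) m -> has_mean P (fun o => kS i o * phi (x o)) m.
Proof.
move=> mphi phiS phim.
pose pos y := Num.max (phi y) 0; pose neg y := Num.max (- phi y) 0.
have mpos : measurable_fun setT pos by exact: measurable_maxr.
have mneg : measurable_fun setT neg.
  by apply: measurable_maxr => //; exact: measurableT_comp.
have phiE y : phi y = pos y - neg y.
  by rewrite /pos /neg; have [?|?] := leP (phi y) 0; have [?|?] := leP (- phi y) 0; lra.
have phi_abs : has_mean P (fun o => `|phi (x o)|) (fine (\int[P]_o `|phi (x o)|%:E)).
  apply: integrable_has_mean; have /has_meanE[iphi _] := phim.
  exact: integrable_abse iphi.
have Spos y : support_mx (f y) i i * pos y = pos y.
  have := phiS y; rewrite !mxE eqxx; case: asboolP => /= _; first by rewrite !mul1r.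
  by rewrite !mul0r /pos => <-; rewrite maxxx.
have Sneg y : support_mx (f y) i i * neg y = neg y.
  have := phiS y; rewrite !mxE eqxx; case: asboolP => /= _; first by rewrite !mul1r.
  by rewrite !mul0r /neg => <-; rewrite oppr0 maxxx.
have hpos : has_mean P (pos \o x) (fine (\int[P]_o (pos (x o))%:E)).
  apply: has_mean_dominated phi_abs => [|o]; first exact: measurableT_comp mpos _.
  by rewrite /pos/= le_max lexx orbT/= ge_max ler_norm normr_ge0.
have hneg : has_mean P (neg \o x) (fine (\int[P]_o (neg (x o))%:E)).
  apply: has_mean_dominated phi_abs => [|o]; first exact: measurableT_comp mneg _.
  by rewrite /neg/= le_max lexx orbT/= ge_max ler_normr lexx orbT normr_ge0.
have mE : m = fine (\int[P]_o (pos (x o))%:E) - fine (\int[P]_o (neg (x o))%:E).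
  apply: has_mean_uniq phim _; apply: eq_has_mean (has_meanB hpos hneg) => o.
  by rewrite /= phiE.
rewrite mE; have h1 := @has_mean_filtered_ge0 i pos _ mpos _ Spos hpos.
have h2 := @has_mean_filtered_ge0 i neg _ mneg _ Sneg hneg.
apply: eq_has_mean (has_meanB (h1 _) (h2 _)) => [z|y|y].
- by rewrite [in RHS]phiE mulrBr.
- by rewrite /pos le_max lexx orbT.
- by rewrite /neg le_max lexx orbT.
Qed.

End filtered_moments.

(** * The stochastic gradient at a frozen point *)

Lemma mul1Br_le_quarter (R : realFieldType) (s : R) : (1 - s) * s <= 4^-1.
Proof. by have := sqr_ge0 (s - 2^-1); rewrite sqrrB; lra. Qed.

(** Last step of [gradF_min]: a, V are the squared norms of the gradients at the shifted point and
    at [wstar], b their inner product. The hypotheses squeeze V below V / 4. *)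
Lemma quarter_absorb (R : realFieldType) (a b c V : R) :
  0 <= a -> b <= 0 -> 0 <= V -> a - 2 * b + V <= c -> c <= 4^-1 * V -> V <= 0.
Proof. by lra. Qed.

Section stochastic_gradient.
Context (dO dX : measure_display) (Omega : measurableType dO)
  (Xi : measurableType dX) (R : realType) (n : nat) (P : probability Omega R).
Variables (xi : {RV P >-> Xi}) (f : Xi -> 'rV[R]_n -> R) (F : 'rV[R]_n -> R)
  (mu L N : R) (wstar : 'rV[R]_n).
Hypotheses (f_meas : forall w, measurable_fun setT (fun x => f x w))
  (f_diff : forall x w, differentiable (f x : 'rV[R]_n -> R^o) w)
  (gradF_mean : forall w i,
     has_mean P (fun o => grad (f (xi o)) w 0 i) (grad F w 0 i))
  (mu_gt0 : 0 < mu) (F_strong : strongly_convex mu F)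
  (L_gt0 : 0 < L) (f_smooth : forall x, smooth L (f x))
  (wstar_min : forall w, F wstar <= F w)
  (N_def : (N%:E = 2%:E *
     'E_P[fun o => (enorm (grad (f (xi o)) wstar) ^+ 2)%R])%E).

Let mgrad w i : measurable_fun setT (fun x => grad (f x) w 0 i).
Proof. exact: measurable_fun_grad. Qed.

Lemma grad_coord_lipschitz x w w' i :
  `|grad (f x) w 0 i - grad (f x) w' 0 i| <= L * enorm (w - w').
Proof.
apply: le_trans (f_smooth x w w'); apply: le_trans (norm_coord_le_enorm _ i).
by rewrite !mxE.
Qed.

(** Each coordinate of grad F is a mean of L-Lipschitz functions, hence L-Lipschitz; summing the n
    squares gives the factor n. *)
Lemma gradF_lipschitz_sqr w w' :
  enorm (grad F w - grad F w') ^+ 2 <= n%:R * L ^+ 2 * enorm (w - w') ^+ 2.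
Proof.
rewrite enorm_sqr_sum -mulrA -exprMn mulr_natl -[X in _ *+ X](card_ord n) -sumr_const.
apply: ler_sum => i _.
have LE0 : 0 <= L * enorm (w - w') by rewrite mulr_ge0 ?enorm_ge0// ltW.
rewrite -real_normK ?num_real// lerXn2r ?nnegrE//.
have dm := has_meanB (gradF_mean w i) (gradF_mean w' i).
rewrite !mxE in dm *; rewrite ler_norml; apply/andP; split.
  apply: has_mean_le (has_mean_cst P _) dm _ => o.
  by have := grad_coord_lipschitz (xi o) w w' i; rewrite !mxE ler_norml => /andP[].
apply: has_mean_le dm (has_mean_cst P _) _ => o.
by have := grad_coord_lipschitz (xi o) w w' i; rewrite !mxE ler_norml => /andP[].
Qed.

(** Sum of the two strong convexity inequalities between [w] and [wstar]. *)
Lemma gradF_monotone w : mu * enorm (w - wstar) ^+ 2 <=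
  dotv (grad F w) (w - wstar) - dotv (grad F wstar) (w - wstar).
Proof.
have := F_strong w wstar; have := F_strong wstar w.
rewrite -opprB enormN.
have -> : dotv (grad F w) (- (w - wstar)) = - dotv (grad F w) (w - wstar).
  by rewrite /dotv -sumrN; apply: eq_bigr => i _; rewrite !mxE mulrN.
by lra.
Qed.

(* With v = grad F wstar, strong convexity at wstar - s v gives
   <grad F (wstar - s v), v> <= 0, so that the Lipschitz bound yields
   |v|^2 <= n L^2 s^2 |v|^2 for every s > 0. *)
Lemma gradF_min : grad F wstar = 0.
Proof.
set v := grad F wstar.
(* With s = 1 / c one has n L^2 s^2 = (c - 1) / c^2 = (1 - s) s, which is at most 1 / 4. *)
pose c := n%:R * L ^+ 2 + 1.
have c1 : 1 <= c by rewrite lerDr mulr_ge0// sqr_ge0.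
pose s := c^-1; pose w := wstar - s *: v.
have c0 : 0 < c by lra.
have s0 : 0 < s by rewrite invr_gt0.
have dvv : dotv (grad F w) v <= 0.
  have := F_strong wstar w; have := wstar_min w.
  have -> : wstar - w = s *: v by rewrite /w opprB addrC subrK.
  have -> : dotv (grad F w) (s *: v) = s * dotv (grad F w) v.
    by rewrite /dotv mulr_sumr; apply: eq_bigr => i _; rewrite [(s *: v) 0 i]mxE mulrCA.
  have : 0 <= mu / 2 * enorm (s *: v) ^+ 2 by rewrite mulr_ge0 ?sqr_ge0// divr_ge0// ltW.
  move=> h1 h2 h3; have : s * dotv (grad F w) v <= 0 by lra.
  by rewrite pmulr_rle0.
have lip := gradF_lipschitz_sqr w wstar.
have wE : w - wstar = - (s *: v) by rewrite /w addrAC subrr sub0r.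
rewrite wE enormN enormZ_sqr -/v in lip.
rewrite enorm_sub_sqr in lip.
have v0 : enorm v ^+ 2 <= 0.
  have dC : dotv v (grad F w) = dotv (grad F w) v.
    by apply: eq_bigr => i _; rewrite mulrC.
  rewrite dC in lip.
  have sc : n%:R * L ^+ 2 * (s ^+ 2 * enorm v ^+ 2) = (1 - s) * s * enorm v ^+ 2.
    have -> : n%:R * L ^+ 2 = c - 1 by rewrite /c addrK.
    by rewrite /s; field; rewrite gt_eqF.
  rewrite sc in lip.
  apply: (quarter_absorb _ dvv _ lip) => //; rewrite ?sqr_ge0//.
  by rewrite ler_wpM2r ?sqr_ge0// mul1Br_le_quarter.
apply/rowP => i; rewrite [RHS]mxE; apply/eqP; rewrite -normr_eq0.
have := norm_coord_le_enorm v i.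
have -> : enorm v = 0.
  by apply/eqP; rewrite -sqrf_eq0 eq_le v0 sqr_ge0.
by rewrite normr_le0 normr_eq0.
Qed.

Lemma gradF_coercive w :
  mu * enorm (w - wstar) ^+ 2 <= dotv (grad F w) (w - wstar).
Proof.
have := gradF_monotone w; rewrite gradF_min.
suff -> : dotv 0 (w - wstar) = 0 by rewrite subr0.
by rewrite /dotv big1// => i _; rewrite mxE mul0r.
Qed.

Lemma gradF_norm_sqr w :
  enorm (grad F w) ^+ 2 <= n%:R * L ^+ 2 * enorm (w - wstar) ^+ 2.
Proof. by have := gradF_lipschitz_sqr w wstar; rewrite gradF_min subr0. Qed.

(** [N_def] equates the expectation with a real number, so it is finite, and a nonnegative
    measurable variable of finite integral is integrable. *)
Lemma has_mean_grad_wstar :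
  has_mean P (fun o => enorm (grad (f (xi o)) wstar) ^+ 2) (N / 2).
Proof.
apply: ge0_has_mean => [|o|]; last 1 first.
- rewrite [N / 2]mulrC EFinM N_def muleA -EFinM mulVf ?pnatr_eq0// mul1e.
  by rewrite unlock.
- rewrite (_ : (fun _ => _) = fun o => \sum_(i < n) grad (f (xi o)) wstar 0 i ^+ 2).
    apply: measurable_sum => i; apply: measurable_funX.
    exact: (measurableT_comp (mgrad wstar i) (measurable_funP xi)).
  by apply/funext => o; rewrite enorm_sqr_sum.
- exact: sqr_ge0.
Qed.

Lemma noise_ge0 : 0 <= N.
Proof.
have : 0 <= N / 2.
  apply: has_mean_le (has_mean_cst P 0) has_mean_grad_wstar _ => o.
  exact: sqr_ge0.
by lra.
Qed.

(** The gradient at [w] is compared with the gradient at [wstar]: smoothness bounds the difference,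
    N the rest. The coordinates are kept apart because filters act on them separately. *)
Lemma grad_second_moment w : exists2 s : 'I_n -> R,
  forall i, has_mean P (fun o => grad (f (xi o)) w 0 i ^+ 2) (s i) &
  \sum_i s i <= 2 * L ^+ 2 * enorm (w - wstar) ^+ 2 + N.
Proof.
pose Y o := 2 * L ^+ 2 * enorm (w - wstar) ^+ 2 +
  2 * enorm (grad (f (xi o)) wstar) ^+ 2.
have hY : has_mean P Y (2 * L ^+ 2 * enorm (w - wstar) ^+ 2 + N).
  have := has_meanD (has_mean_cst P (2 * L ^+ 2 * enorm (w - wstar) ^+ 2))
    (has_meanZ 2 has_mean_grad_wstar).
  by have -> : 2 * (N / 2) = N by field.
have leY o : \sum_i grad (f (xi o)) w 0 i ^+ 2 <= Y o.
  rewrite -enorm_sqr_sum -[grad _ w](subrK (grad (f (xi o)) wstar)).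
  apply: (le_trans (enormD_sqr_le _ _)); rewrite lerD2r -mulrA ler_pM2l//.
  rewrite -exprMn; apply: lerXn2r; rewrite ?nnegrE ?enorm_ge0//.
    by rewrite mulr_ge0 ?enorm_ge0// ltW.
  exact: f_smooth.
have hs i : has_mean P (fun o => grad (f (xi o)) w 0 i ^+ 2)
    (fine (\int[P]_o (grad (f (xi o)) w 0 i ^+ 2)%:E)).
  apply: has_mean_dominated hY => [|z].
    apply: measurable_funX.
    exact: (measurableT_comp (mgrad w i) (measurable_funP xi)).
  rewrite sqr_ge0/=; apply: le_trans (leY z).
  by rewrite (bigD1 i)//= lerDl sumr_ge0// => j _; rewrite sqr_ge0.
eexists; first exact: hs.
exact: has_mean_le (has_mean_sum (fun i _ => hs i)) hY leY.
Qed.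

Variables (D : nat) (Ss : Xi -> seq 'M[R]_n).
Hypotheses (D_gt0 : (0 < D)%N)
  (Ss_filters : forall x, filters_of D (support_mx (f x)) (Ss x))
  (Ss_meas : forall u i k,
    measurable_fun setT (fun x => filter_mx (Ss x) u i k)).

(** The update direction. Sample and index form one argument because they are integrated out
    together. *)
Definition filtered_grad (p : Xi * nat) (w : 'rV[R]_n) : 'rV[R]_n :=
  (size (Ss p.1))%:R *: (grad (f p.1) w *m filter_mx (Ss p.1) p.2).

Lemma filtered_grad_coord p w i : filtered_grad p w 0 i =
  (size (Ss p.1))%:R * filter_mx (Ss p.1) p.2 i i * grad (f p.1) w 0 i.
Proof.
rewrite mxE mul_diag01; last exact: filter_mx_diag01 (Ss_filters _).
by rewrite mulrCA mulrC.
Qed.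

Variables (x : {RV P >-> Xi}) (u : {RV P >-> nat}).
Hypotheses (x_law : forall B : set Xi, measurable B ->
    P (x @^-1` B) = P (xi @^-1` B))
  (x_u : cond_uniform P x (fun y => size (Ss y)) u).

Lemma has_mean_filtered_grad w i :
  has_mean P (fun o => filtered_grad (x o, u o) w 0 i) (grad F w 0 i).
Proof.
have gm := has_mean_same_law x_law (mgrad w i) (gradF_mean w i).
apply: eq_has_mean (has_mean_filtered D_gt0 Ss_filters Ss_meas x_u (i := i)
  (mgrad w i) _ gm) => [z|y].
  by rewrite filtered_grad_coord.
exact: grad_support.
Qed.

(** A diagonal entry S of a filter satisfies S^2 = S, so (d S g)^2 = d (d S g^2) <= D (d S g^2), and
    d S averages out on g^2. This gives D and not D^2. *)
Lemma filtered_grad_second_moment w : exists2 q : 'I_n -> R,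
  forall i, has_mean P (fun o => filtered_grad (x o, u o) w 0 i ^+ 2) (q i) &
  \sum_i q i <= D%:R * (2 * L ^+ 2 * enorm (w - wstar) ^+ 2 + N).
Proof.
have [s hs sle] := grad_second_moment w.
pose phi i y := grad (f y) w 0 i ^+ 2.
have mphi i : measurable_fun setT (phi i) by apply: measurable_funX.
have hks i := has_mean_filtered_ge0 D_gt0 Ss_filters Ss_meas x_u (i := i)
  (mphi i) (fun=> sqr_ge0 _) _ (has_mean_same_law x_law (mphi i) (hs i)).
have phiS i y : support_mx (f y) i i * phi i y = phi i y.
  by rewrite /phi expr2 mulrA grad_support.
have {}hks i := has_meanZ D%:R (hks phiS i).
have hq i : has_mean P (fun o => filtered_grad (x o, u o) w 0 i ^+ 2)
    (fine (\int[P]_o (filtered_grad (x o, u o) w 0 i ^+ 2)%:E)).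
  apply: has_mean_dominated (hks i) => [|o].
    apply: measurable_funX; exact: has_mean_measurable (has_mean_filtered_grad w i).
  rewrite sqr_ge0/= filtered_grad_coord/=.
  have [_ /(_ i)[->|->]] := filter_mx_diag01 (u o) (Ss_filters (x o)).
    by rewrite !(mulr0, mul0r) expr0n.
  rewrite !mulr1 exprMn expr2 -mulrA ler_wpM2r ?ler_nat ?filters_size_le//.
    by rewrite mulr_ge0// sqr_ge0.
  exact: filters_size_le (Ss_filters _).
exists (fun i => fine (\int[P]_o (filtered_grad (x o, u o) w 0 i ^+ 2)%:E)) => //.
apply: (@le_trans _ _ (\sum_i D%:R * s i)); last first.
  by rewrite -mulr_sumr ler_wpM2l.
apply: ler_sum => i _; apply: has_mean_le (hq i) (hks i) _ => o.
rewrite filtered_grad_coord/=.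
have [_ /(_ i)[->|->]] := filter_mx_diag01 (u o) (Ss_filters (x o)).
  by rewrite !(mulr0, mul0r) expr0n.
rewrite !mulr1 exprMn expr2 -mulrA ler_wpM2r ?ler_nat//.
  by rewrite mulr_ge0// sqr_ge0.
exact: filters_size_le (Ss_filters _).
Qed.

Lemma integral_filtered_grad_sqr w :
  (\int[P]_o (enorm (filtered_grad (x o, u o) w) ^+ 2)%:E <=
   (D%:R * (2 * L ^+ 2 * enorm (w - wstar) ^+ 2 + N))%:E)%E.
Proof.
have [q hq qle] := filtered_grad_second_moment w.
have /has_meanE[_] := has_mean_sum (s := index_enum 'I_n) (fun i _ => hq i).
under eq_integral do rewrite -enorm_sqr_sum.
by move=> ->; rewrite lee_fin.
Qed.

(** Here y stands for w_t - wstar and w for the read; put p = w - wstar and r = y - p, the read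
    discrepancy. Coercivity at the read yields -2 mu |p|^2. Young and the second moment each take
    back mu / 2 |p|^2, and the remaining -mu |p|^2 is at most -mu / 2 |y|^2 + mu |r|^2. *)
Lemma integral_sgd_step (e : R) w y : 0 <= e ->
  4 * D%:R * L ^+ 2 * e <= mu ->
  (\int[P]_o (enorm (y - e *: filtered_grad (x o, u o) w) ^+ 2)%:E <=
   ((1 - mu * e / 2) * enorm y ^+ 2
    + e * (mu + 2 * (n%:R + 1) * L ^+ 2 / mu) * enorm (y - (w - wstar)) ^+ 2
    + e ^+ 2 * (D%:R * N))%:E)%E.
Proof.
move=> e0 emu; have [q hq qle] := filtered_grad_second_moment w.
have /has_meanE[_] := has_mean_sum (s := index_enum 'I_n) (fun i _ =>
  has_mean_affine_sqr (y 0 i) e (has_mean_filtered_grad w i) (hq i)).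
under eq_integral => o _.
  rewrite (_ : \sum_(i < n) _ = enorm (y - e *: filtered_grad (x o, u o) w) ^+ 2).
    over.
  by rewrite enorm_sqr_sum; apply: eq_bigr => i _; rewrite !mxE.
move=> ->; rewrite lee_fin big_split/= sumrB -enorm_sqr_sum.
rewrite -!mulr_sumr -/(dotv (grad F w) y).
set p := w - wstar in qle *; set r := y - p.
have yE : y = p + r by rewrite /r addrC subrK.
have dE : dotv (grad F w) y = dotv (grad F w) p + dotv (grad F w) r.
  by rewrite yE /dotv -big_split/=; apply: eq_bigr => i _; rewrite !mxE mulrDr.
(* The [+ 1] keeps M2 positive in dimension 0. The Young weight [eps] below is chosen so that eps
   |grad F w|^2 <= mu / 2 |p|^2; its inverse is the second summand of the coefficient of |r|^2. *)
pose M2 := (n%:R + 1) * L ^+ 2.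
have L2 : 0 < L ^+ 2 by rewrite exprn_gt0.
have M20 : 0 < M2 by rewrite mulr_gt0// ltr_pwDr.
pose eps := mu / (2 * M2).
have eps0 : 0 < eps by rewrite divr_gt0// mulr_gt0.
have young := dotv_young (grad F w) r eps0.
have gn := gradF_norm_sqr w; have gc := gradF_coercive w; rewrite -/p in gn gc.
have yn := enormD_sqr_le p r; rewrite -yE in yn.
have p0 := sqr_ge0 (enorm p); have r0 := sqr_ge0 (enorm r).
have epsg : eps * enorm (grad F w) ^+ 2 <= mu / 2 * enorm p ^+ 2.
  apply: (@le_trans _ _ (eps * (M2 * enorm p ^+ 2))).
    apply: ler_wpM2l; first exact: ltW.
    by apply: (le_trans gn); rewrite ler_wpM2r// /M2 mulrDl mul1r lerDl ltW.
  by rewrite /eps le_eqVlt; apply/orP; left; apply/eqP; field; rewrite gt_eqF.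
have -> : mu + 2 * (n%:R + 1) * L ^+ 2 / mu = mu + eps^-1.
  by rewrite /eps /M2; field; rewrite !gt_eqF// ltr_pwDr.
have qe : e ^+ 2 * \sum_i q i <=
    e * (mu / 2 * enorm p ^+ 2) + e ^+ 2 * (D%:R * N).
  apply: (@le_trans _ _ (e ^+ 2 * (D%:R * (2 * L ^+ 2 * enorm p ^+ 2 + N)))).
    by rewrite ler_wpM2l// sqr_ge0.
  have -> : e ^+ 2 * (D%:R * (2 * L ^+ 2 * enorm p ^+ 2 + N)) =
     e * ((4 * D%:R * L ^+ 2 * e) / 2 * enorm p ^+ 2) + e ^+ 2 * (D%:R * N) by field.
  rewrite lerD2r ler_wpM2l// ler_wpM2r//; lra.
have cross : - (2 * dotv (grad F w) y) <= - (mu * enorm y ^+ 2) / 2 - mu/2 * enorm p ^+ 2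
     + (mu + eps^-1) * enorm r ^+ 2.
  rewrite dE; have : mu * enorm y ^+ 2 <= mu * (2 * enorm p ^+ 2 + 2 * enorm r ^+ 2).
    by rewrite ler_pM2l.
  lra.
have := ler_wpM2l e0 cross; move: qe; lra.
Qed.

End stochastic_gradient.

(** * The deterministic recursion with delayed errors *)

Section delayed_recursion.
Context (R : realType).

Definition tlnt (t : nat) : R := (t%:R * ln t%:R)^-1.

(** As ln (t + 1) <= ln t + 1 / t and ln t >= 1, the quotient of consecutive terms is at most (1 +
    i)^2 with i = 1 / t, and (1 - 2 i)(1 + i)^2 = 1 - i^2 (3 + 2 i). If 1 - 2 i is negative, the
    left side is too. *)
Lemma tlnt_decrease (t : nat) : 1 <= ln (t%:R : R) ->
  (1 - 2 / t%:R) * tlnt t <= tlnt t.+1.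
Proof.
move=> l1.
have t1 : (1 < t)%N.
  rewrite ltnNge; apply/negP => tle1; have : ln (t%:R : R) <= 0.
    by apply: ln_le0; rewrite lern1.
  by lra.
set T : R := t%:R in l1 *; have T1 : 1 < T by rewrite ltr1n.
have TS : t.+1%:R = T + 1 :> R by rewrite -natr1.
rewrite /tlnt TS -/T; set l := ln T in l1 *; set l' := ln (T + 1).
have ll' : l <= l' by rewrite ler_ln ?posrE ?lerDl//; lra.
have l'le : l' <= l + T^-1.
  rewrite /l' (_ : T + 1 = T * (1 + T^-1)); last by field; lra.
  rewrite lnM ?posrE; [|lra|]; last by rewrite addr_gt0// invr_gt0; lra.
  rewrite lerD2l le_ln1Dx//; apply: (@lt_trans _ _ 0); first by lra.
  by rewrite invr_gt0; lra.
have l'0 : 0 < l' by lra.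
have Tl0 : 0 < (T + 1) * l' by rewrite mulr_gt0//; lra.
rewrite -(ler_pM2r Tl0) mulVf ?gt_eqF//.
have -> : (1 - 2 / T) * (T * l)^-1 * ((T + 1) * l') =
   ((1 - 2 / T) * (1 + T^-1)) * (l' / l) by field; apply/andP; split; lra.
have r1 : l' / l <= 1 + T^-1.
  rewrite ler_pdivrMr; last by lra.
  apply: (le_trans l'le); rewrite mulrDl mul1r lerD2l ler_peMr// invr_ge0; lra.
set i := T^-1 in r1 *.
have i0 : 0 < i by rewrite invr_gt0; lra.
have i1 : i <= 1 by rewrite invf_le1; lra.
have [h|h] := leP 0 (1 - 2 * i).
  apply: (@le_trans _ _ ((1 - 2 * i) * (1 + i) * (1 + i))).
    by rewrite ler_wpM2l// mulr_ge0//; lra.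
  have : 0 <= i ^+ 2 * (3 + 2 * i) by rewrite mulr_ge0 ?sqr_ge0//; lra.
  lra.
apply: (@le_trans _ _ 0) => //; rewrite mulr_le0_ge0 ?divr_ge0//; [|lra|lra].
by rewrite mulr_le0_ge0//; lra.
Qed.

Lemma inv_decrease (t : nat) : (0 < t)%N ->
  (1 - t%:R^-1) * t%:R^-1 <= t.+1%:R^-1 :> R.
Proof.
move=> t0; have T0 : 0 < t%:R :> R by rewrite ltr0n.
rewrite -natr1; set T : R := t%:R in T0 *.
have T10 : 0 < T + 1 by lra.
rewrite -(ler_pM2r T10) mulVf ?gt_eqF//.
have -> : (1 - T^-1) * T^-1 * (T + 1) = 1 - T^-1 ^+ 2 by field; lra.
by rewrite gerBl sqr_ge0.
Qed.

Variables (mu alpha : R) (alpha_ eta : nat -> R) (tau : nat -> nat).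
Hypotheses (mu_gt0 : 0 < mu)
  (tau_le : \forall t \near \oo, (tau t)%:R <=
     Num.sqrt (t%:R * ((ln t%:R)^-1 - (ln t%:R ^+ 2)^-1)) :> R)
  (alpha_bounds : forall t, 12 <= alpha_ t <= alpha)
  (eta_def : forall t, eta t = alpha_ t / (mu * (t%:R + 2 * (tau t)%:R))).

Let alpha_gt0 : 0 < alpha.
Proof. by have /andP[] := alpha_bounds 0; lra. Qed.

Lemma step_ge0 t : 0 <= eta t.
Proof.
rewrite eta_def divr_ge0//; first by have /andP[] := alpha_bounds t; lra.
by rewrite mulr_ge0 ?addr_ge0 ?mulr_ge0// ltW.
Qed.

Lemma step_le t : (0 < t)%N -> eta t <= alpha / (mu * t%:R).
Proof.
move=> t0; have T0 : 0 < t%:R :> R by rewrite ltr0n.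
have tau0 : 0 <= (tau t)%:R :> R by [].
rewrite eta_def; apply: ler_pM.
- by have /andP[] := alpha_bounds t; lra.
- by rewrite invr_ge0 mulr_ge0 ?ltW//; lra.
- by have /andP[] := alpha_bounds t.
- by rewrite lef_pV2 ?posrE ?mulr_gt0 ?ler_pM2l//; lra.
Qed.

Lemma near_step_le (e : R) : 0 < e -> \forall t \near \oo, eta t <= e.
Proof.
move=> e0; near=> t.
have t0 : (0 < t)%N by near: t; exists 1%N.
have T0 : 0 < t%:R :> R by rewrite ltr0n.
apply: (le_trans (step_le t0)).
rewrite ler_pdivrMr ?mulr_gt0// mulrA -ler_pdivrMl ?mulr_gt0//.
by near: t; exact: nbhs_infty_ger.
Unshelve. all: by end_near. Qed.

(** The form in which the delay condition is used. The last bound is its square; for t >= 4 it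
    implies (2 tau)^2 <= 4 t / ln t <= t^2, so that read windows stay in the upper half of
    [0, t]. *)
Lemma near_delay : \forall t \near \oo,
  [/\ 1 <= ln (t%:R : R), (2 * tau t <= t)%N &
      (tau t)%:R ^+ 2 <= t%:R / ln (t%:R : R)].
Proof.
near=> t.
have t4 : 4 <= t%:R :> R by near: t; exact: nbhs_infty_ger.
have T0 : 0 < t%:R :> R by lra.
have l1 : 1 <= ln (t%:R : R).
  rewrite -[leLHS]expRK ler_ln ?posrE ?expR_gt0//.
  by near: t; exact: nbhs_infty_ger.
have tau0 : 0 <= (tau t)%:R :> R by [].
have tau2 : (tau t)%:R ^+ 2 <= t%:R / ln (t%:R : R).
  apply: (@le_trans _ _ (t%:R * ((ln t%:R)^-1 - (ln t%:R ^+ 2)^-1))).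
    (* [Num.sqrt] vanishes on negative numbers; ln t >= 1 makes the radicand nonnegative, so that
       squaring returns it. *)
    rewrite -[leRHS]sqr_sqrtr; last first.
      rewrite mulr_ge0// subr_ge0 lef_pV2 ?posrE ?exprn_gt0//; [|lra|lra].
      by rewrite expr2 ler_peMl//; lra.
    apply: lerXn2r; rewrite ?nnegrE ?sqrtr_ge0//.
    by near: t.
  by rewrite ler_wpM2l// gerBl invr_ge0 sqr_ge0.
split => //.
rewrite -(@ler_nat R) natrM -(@ler_pXn2r _ 2)// ?nnegrE// ?mulr_ge0//.
rewrite exprMn; apply: (@le_trans _ _ (2 ^+ 2 * (t%:R / ln t%:R))).
  by rewrite ler_wpM2l.
rewrite expr2 mulrA ler_pdivrMr; last by lra.
have -> : 2 * 2 * t%:R = 4 * t%:R :> R by ring.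
apply: (@le_trans _ _ (t%:R ^+ 2)); first by rewrite expr2 ler_wpM2r.
by rewrite ler_peMr// sqr_ge0.
Unshelve. all: by end_near. Qed.

Variables (a b ah : nat -> R) (K1 K2 V e0 : R).
Hypotheses (K1_ge0 : 0 <= K1) (K2_ge0 : 0 <= K2) (V_ge0 : 0 <= V) (e0_gt0 : 0 < e0)
  (a_ge0 : forall t, 0 <= a t) (ah_ge0 : forall t, 0 <= ah t)
  (a_rec : forall t, eta t <= e0 ->
     a t.+1 <= (1 - mu * eta t / 2) * a t + eta t * K1 * b t + eta t ^+ 2 * V)
  (b_le : forall t, b t <= (tau t)%:R *
     \sum_(t - tau t <= j < t) eta j ^+ 2 * (K2 * ah j + V))
  (ah_le : forall t, ah t <= 2 * a t + 2 * b t).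

Let Q := 4 * alpha ^+ 2 / mu ^+ 2.
Let Q_ge0 : 0 <= Q.
Proof. by apply: divr_ge0; [apply: mulr_ge0 => //|]; exact: sqr_ge0. Qed.

(** Indices in the window are at least t / 2, so eta_j <= 2 alpha / (mu t), whose square is Q / t^2;
    at most tau terms and the prefactor tau give tau^2 <= t / ln t. The threshold on t is uniform in
    M, as M is fixed only afterwards, in terms of that threshold. *)
Lemma near_delay_error_le : \forall t \near \oo, forall M, 0 <= M ->
  (forall j, (j < t)%N -> ah j <= M) -> b t <= Q * (K2 * M + V) * tlnt t.
Proof.
near=> t => M M0 hM.
have [l1 tau1 tau2] : [/\ 1 <= ln (t%:R : R), (2 * tau t <= t)%N &
      (tau t)%:R ^+ 2 <= t%:R / ln (t%:R : R)] by near: t; exact: near_delay.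
have t0 : (0 < t)%N by near: t; exists 1%N.
have T0 : 0 < t%:R :> R by rewrite ltr0n.
have KV0 : 0 <= K2 * M + V by rewrite addr_ge0 ?mulr_ge0.
apply: (le_trans (b_le t)).
pose c := Q / t%:R ^+ 2 * (K2 * M + V).
have c0 : 0 <= c by rewrite mulr_ge0// divr_ge0// sqr_ge0.
apply: (@le_trans _ _ ((tau t)%:R * (\sum_(t - tau t <= j < t) c))).
  rewrite ler_wpM2l//; apply: ler_sum_nat => j /andP[jl jt].
  have j0 : (0 < j)%N by move: tau1 jl t0; clear; lia.
  have J0 : 0 < j%:R :> R by rewrite ltr0n.
  have tj : t%:R <= 2 * j%:R :> R.
    by rewrite -natrM ler_nat; move: tau1 jl; clear; lia.
  apply: ler_pM; rewrite ?sqr_ge0//.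
  - by rewrite addr_ge0// mulr_ge0.
  - have -> : Q / t%:R ^+ 2 = (2 * alpha / (mu * t%:R)) ^+ 2.
      by rewrite /Q; field; rewrite !gt_eqF.
    apply: lerXn2r; rewrite ?nnegrE ?step_ge0//.
      by rewrite divr_ge0 ?mulr_ge0// ltW.
    apply: (le_trans (step_le j0)).
    rewrite ler_pdivrMr ?mulr_gt0//.
    have -> : 2 * alpha / (mu * t%:R) * (mu * j%:R) = alpha * ((2 * j%:R) / t%:R).
      by field; rewrite !gt_eqF.
    apply: ler_peMr; first exact: ltW.
    by rewrite ler_pdivlMr// mul1r.
  - by rewrite lerD2r ler_wpM2l// hM.
rewrite sumr_const_nat -[c *+ _]mulr_natr [X in _ * X]mulrC mulrA.
have win : (t - (t - tau t))%:R <= (tau t)%:R :> R.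
  by rewrite ler_nat; move: tau1; clear; lia.
apply: (@le_trans _ _ ((tau t)%:R ^+ 2 * c)).
  by rewrite expr2 ler_wpM2r// ler_wpM2l.
apply: (@le_trans _ _ (t%:R / ln t%:R * c)); first by rewrite ler_wpM2r.
rewrite /c /tlnt le_eqVlt; apply/orP; left; apply/eqP; field.
by rewrite !gt_eqF//; lra.
Unshelve. all: by end_near. Qed.

Lemma near_tlnt_le (d : R) : 0 < d -> \forall t \near \oo, tlnt t <= d.
Proof.
move=> d0; near=> t.
have [l1 _ _] : [/\ 1 <= ln (t%:R : R), (2 * tau t <= t)%N &
      (tau t)%:R ^+ 2 <= t%:R / ln (t%:R : R)] by near: t; exact: near_delay.
have t0 : (0 < t)%N by near: t; exists 1%N.
have T0 : 0 < t%:R :> R by rewrite ltr0n.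
apply: (@le_trans _ _ (t%:R^-1)).
  have l0 : 0 < ln (t%:R : R) by lra.
  by rewrite lef_pV2 ?posrE ?mulr_gt0// ler_peMr.
rewrite invf_ple ?posrE//; near: t; exact: nbhs_infty_ger.
Unshelve. all: by end_near. Qed.

(* Induction with the two thresholds a <= M / 4 and ah <= M; M dominates the
   finitely many terms before the recursion becomes contracting. *)
Lemma reads_bounded : exists2 M, 0 <= M & forall t, ah t <= M.
Proof.
pose S := K2 + V.
have S0 : 0 <= S by rewrite addr_ge0.
(* Budget of the induction step: contraction frees (mu eta / 2)(M / 4) = mu eta M / 8, and read
   error and noise may take mu eta M / 16 each. The second bound on d gives 2 b <= M / 2, hence ah
   <= M. Each [+ 1] only keeps a denominator positive. *)
pose d := Num.min (mu / (16 * (K1 * S + 1))) (1 / (4 * (S + 1))).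
have KS0 : 0 <= K1 * S by rewrite mulr_ge0.
have d0 : 0 < d by rewrite lt_min !divr_gt0// ?mulr_gt0//; lra.
have dK : K1 * (d * S) <= mu / 16.
  have d1 : d <= mu / (16 * (K1 * S + 1)) by rewrite ge_min lexx.
  apply: (@le_trans _ _ (mu / (16 * (K1 * S + 1)) * (K1 * S + 1))).
    have -> : K1 * (d * S) = d * (K1 * S) by ring.
    by apply: ler_pM => //; [exact: ltW|lra].
  by rewrite le_eqVlt; apply/orP; left; apply/eqP; field; lra.
have dS : d * S <= 1 / 4.
  have d1 : d <= 1 / (4 * (S + 1)) by rewrite ge_min lexx orbT.
  apply: (@le_trans _ _ (1 / (4 * (S + 1)) * (S + 1))).
    by apply: ler_pM => //; [exact: ltW|lra].
  by rewrite le_eqVlt; apply/orP; left; apply/eqP; field; lra.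
pose e1 := Num.min e0 (Num.min (2 / mu) (mu / (16 * (V + 1)))).
have V1 : 0 < V + 1 by rewrite ltr_wpDl.
have e10 : 0 < e1 by rewrite !lt_min e0_gt0 !divr_gt0// mulr_gt0.
have e1V : e1 * V <= mu / 16.
  have e1le : e1 <= mu / (16 * (V + 1)) by rewrite !ge_min lexx !orbT.
  apply: (@le_trans _ _ (mu / (16 * (V + 1)) * (V + 1))).
    by apply: ler_pM => //; [exact: ltW|rewrite lerDl].
  by rewrite le_eqVlt; apply/orP; left; apply/eqP; field; rewrite gt_eqF.
have Q1 : 0 < Q + 1 by rewrite ltr_wpDl.
have d'0 : 0 < d / (Q + 1) by rewrite divr_gt0.
have := filterI (near_delay_error_le) (filterI (near_tlnt_le d'0) (near_step_le e10)).
move=> [T _ HT].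
have {}HT t : (T <= t)%N -> [/\ (forall M, 0 <= M ->
    (forall j, (j < t)%N -> ah j <= M) -> b t <= d * (K2 * M + V)),
    eta t <= e1 & eta t <= e0].
  move=> Tt; have [h1 [h2 h3]] := HT _ Tt; split => // [M M0 hM|].
    apply: (le_trans (h1 M M0 hM)).
    have KM : 0 <= K2 * M + V by rewrite addr_ge0 ?mulr_ge0.
    rewrite mulrAC ler_wpM2r//.
    apply: (@le_trans _ _ (Q * (d / (Q + 1)))); first exact: ler_wpM2l.
    rewrite mulrA ler_pdivrMr// [leLHS]mulrC ler_pM2l//.
    by rewrite lerDl.
  by apply: (le_trans h3); rewrite ge_min lexx.
pose M := 1 + 4 * \sum_(j < T.+1) (a j + ah j).
have Sig0 : 0 <= \sum_(j < T.+1) (a j + ah j).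
  by apply: sumr_ge0 => j _; rewrite addr_ge0.
have M1 : 1 <= M by rewrite /M; lra.
have M0 : 0 <= M by lra.
exists M => // t.
suff: a t <= M / 4 /\ ah t <= M by case.
have [m tm] := ubnP t; elim: m t tm => // m IH t; rewrite ltnS => tm.
have [tT|Tt] := leqP t T.
  have : a t + ah t <= \sum_(j < T.+1) (a j + ah j).
    rewrite (bigD1 (Ordinal (tT : (t < T.+1)%N)))//= lerDl.
    by apply: sumr_ge0 => j _; rewrite addr_ge0.
  by rewrite /M; have := a_ge0 t; have := ah_ge0 t; lra.
have KMV : K2 * M + V <= S * M.
  by rewrite /S mulrDl lerD2l ler_peMr.
(* The case s = t is included: b t involves only reads before t, so it is bounded before ah t is. *)
have bM s : (T <= s <= t)%N -> b s <= (d * S) * M.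
  move=> /andP[Ts st]; have [h _ _] := HT _ Ts.
  apply: (le_trans (h M M0 _)) => [j js|].
    by have [] := IH j (leq_trans js (leq_trans st tm)).
  by rewrite -mulrA ler_wpM2l// ltW.
case: t tm Tt bM => // t tm; rewrite ltnS => Tt bM.
have [_ et1 et0] := HT _ Tt.
have [at4 _] := IH t tm.
have bt := bM t; rewrite Tt leqnSn in bt; have {}bt := bt isT.
have bt1 := bM t.+1; rewrite (leqW Tt) leqnn in bt1; have {}bt1 := bt1 isT.
have eta0 := step_ge0 t.
have e2 : eta t <= 2 / mu by apply: (le_trans et1); rewrite !ge_min lexx orbT.
have coef : 0 <= 1 - mu * eta t / 2.
  by move: e2; rewrite ler_pdivlMr//; lra.
have aS : a t.+1 <= M / 4.
  apply: (le_trans (a_rec et0)).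
  have h1 : (1 - mu * eta t / 2) * a t <= (1 - mu * eta t / 2) * (M / 4).
    exact: ler_wpM2l.
  have h2 : eta t * K1 * b t <= eta t * (mu / 16 * M).
    rewrite -mulrA ler_wpM2l//; apply: (@le_trans _ _ (K1 * (d * S * M))).
      exact: ler_wpM2l.
    by rewrite mulrA ler_wpM2r.
  have h3 : eta t ^+ 2 * V <= eta t * (mu / 16 * M).
    rewrite expr2 -mulrA ler_wpM2l//; apply: (@le_trans _ _ (mu / 16)).
      by apply: le_trans e1V; rewrite ler_wpM2r.
    by rewrite ler_peMr// divr_ge0// ltW.
  lra.
split => //; apply: (le_trans (ah_le _)).
have : d * S * M <= 1 / 4 * M by rewrite ler_wpM2r.
lra.
Qed.

Lemma delayed_recursion_rate : exists2 K, 0 <= K & \forall t \near \oo,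
  a t <= alpha ^+ 2 * V / mu ^+ 2 * t%:R^-1 + K * tlnt t /\ b t <= K * tlnt t.
Proof.
have [M M0 ahM] := reads_bounded.
pose B := Q * (K2 * M + V).
have B0 : 0 <= B by rewrite mulr_ge0// addr_ge0// mulr_ge0.
have e20 : 0 < Num.min e0 (2 / mu) by rewrite lt_min e0_gt0 divr_gt0.
have := filterI near_delay_error_le (filterI near_delay (near_step_le e20)).
move=> [T0 _ HT0]; pose T := T0.+1.
have {HT0} HT t : (T <= t)%N -> [/\ b t <= B * tlnt t, 1 <= ln (t%:R : R),
    (2 * tau t <= t)%N, eta t <= e0 & eta t <= 2 / mu].
  move=> Tt; have [h1 [[l1 h2 _] h3]] := HT0 _ (ltnW Tt).
  split => //; first exact: h1.
    by apply: (le_trans h3); rewrite ge_min lexx.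
  by apply: (le_trans h3); rewrite ge_min lexx orbT.
pose C := alpha ^+ 2 * V / mu ^+ 2.
have C0 : 0 <= C by rewrite divr_ge0 ?sqr_ge0// mulr_ge0// sqr_ge0.
have K1a : 0 <= K1 * alpha * B / mu.
  apply: divr_ge0; last exact: ltW.
  by apply: mulr_ge0 => //; apply: mulr_ge0 => //; exact: ltW.
have tlnt0 t : (T <= t)%N -> 0 < tlnt t.
  move=> Tt; have [_ l1 _ _ _] := HT _ Tt.
  rewrite invr_gt0 mulr_gt0//; last by lra.
  by rewrite ltr0n; exact: leq_trans Tt.
(* In turn, the summands bound b, absorb the read error in one step of the recursion, and start the
   induction at T. *)
pose K := B + K1 * alpha * B / mu + a T / tlnt T.
have aT0 : 0 <= a T / tlnt T by rewrite divr_ge0// ltW// tlnt0.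
have KB : B <= K by rewrite /K; lra.
have KK : K1 * alpha * B / mu <= K by rewrite /K; lra.
exists K; first by lra.
exists T => // t /= Tt; split; last first.
  have [h _ _ _ _] := HT _ Tt; apply: (le_trans h).
  by rewrite ler_wpM2r// ltW// tlnt0.
rewrite -/C; elim: t Tt => // t IH; rewrite leq_eqVlt => /orP[/eqP <-|].
  apply: (@le_trans _ _ (K * tlnt T)); last by rewrite lerDr mulr_ge0.
  by rewrite -ler_pdivrMr ?tlnt0// /K; lra.
rewrite ltnS => Tt; have {}IH := IH Tt.
have [bt l1 taut et0 et2] := HT _ Tt.
have t0 : (0 < t)%N by exact: leq_trans Tt.
have p0 := tlnt0 _ Tt.
have dec1 := inv_decrease t0; have dec2 := tlnt_decrease l1.
have T0' : 0 < t%:R :> R by rewrite ltr0n.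
have tinv : 0 < t%:R^-1 :> R by rewrite invr_gt0.
have eta0 := step_ge0 t; have etale := step_le t0.
have coef : 0 <= 1 - mu * eta t / 2.
  by move: et2; rewrite ler_pdivlMr//; lra.
(* Origin of the constant 12: since 2 tau t <= t, the denominator t + 2 tau t is at most 2 t, and mu
   eta t / 2 >= 12 / (4 t). *)
have etage : 3 * t%:R^-1 <= mu * eta t / 2.
  have -> : mu * eta t / 2 = alpha_ t / (2 * (t%:R + 2 * (tau t)%:R)).
    by rewrite eta_def; field; rewrite !gt_eqF// ltr_pwDl// mulr_ge0.
  have taut' : 2 * (tau t)%:R <= t%:R :> R by rewrite -natrM ler_nat.
  have tau0 : 0 <= (tau t)%:R :> R by [].
  rewrite ler_pdivlMr; last by lra.
  apply: (@le_trans _ _ 12); last by have /andP[] := alpha_bounds t.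
  have -> : 12 = 3 / t%:R * (2 * (t%:R + t%:R)) :> R by field; rewrite gt_eqF.
  by rewrite ler_wpM2l ?divr_ge0//; lra.
set i := t%:R^-1 in IH dec1 dec2 tinv etage *; set p := tlnt t in bt IH dec2 p0 *.
have etai : eta t <= alpha / mu * i by rewrite /i -mulrA -invfM.
apply: (le_trans (a_rec et0)).
have h1 : (1 - mu * eta t / 2) * a t <= (1 - 3 * i) * (C * i + K * p).
  apply: (@le_trans _ _ ((1 - mu * eta t / 2) * (C * i + K * p))).
    exact: ler_wpM2l.
  have Kp : 0 <= K * p by rewrite mulr_ge0 ?(ltW p0)//; lra.
  by rewrite ler_wpM2r ?lerB// addr_ge0// mulr_ge0// ltW.
have h2 : eta t * K1 * b t <= K * (i * p).
  apply: (@le_trans _ _ (eta t * K1 * (B * p))); first by rewrite ler_wpM2l// mulr_ge0.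
  apply: (@le_trans _ _ (alpha / mu * i * (K1 * (B * p)))).
    have KBp : 0 <= K1 * (B * p).
      by apply: mulr_ge0 => //; apply: mulr_ge0 => //; exact: ltW.
    by rewrite -mulrA ler_wpM2r.
  have -> : alpha / mu * i * (K1 * (B * p)) = (K1 * alpha * B / mu) * (i * p) by ring.
  by rewrite ler_wpM2r// mulr_ge0 ?(ltW p0) ?(ltW tinv).
have h3 : eta t ^+ 2 * V <= C * i ^+ 2.
  have -> : C * i ^+ 2 = (alpha / mu * i) ^+ 2 * V by rewrite /C; field; rewrite gt_eqF.
  rewrite ler_wpM2r//; apply: lerXn2r; rewrite ?nnegrE//.
  by rewrite mulr_ge0 ?divr_ge0// ltW.
have Ci : 0 <= C * i ^+ 2 by rewrite mulr_ge0// sqr_ge0.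
have g1 : C * ((1 - i) * i) <= C * t.+1%:R^-1 by rewrite ler_wpM2l.
have g2 : K * ((1 - 2 * i) * p) <= K * tlnt t.+1 by rewrite ler_wpM2l//; lra.
apply: (le_trans (lerD (lerD h1 h2) h3)); apply: (le_trans _ (lerD g1 g2)).
(* Of the rate 3 i, the C-part spends one i on the decrease of 1 / t and one on the noise; the
   K-part spends two on the decrease of [tlnt] and one on the read error. *)
have -> : (1 - 3 * i) * (C * i + K * p) + K * (i * p) + C * i ^+ 2 =
  C * ((1 - i) * i) + K * ((1 - 2 * i) * p) - C * i ^+ 2 by ring.
by rewrite gerBl.
Qed.

End delayed_recursion.

(** * The Hogwild process: measurability with respect to the history *)

Section hogwild.
Context (R : realType) (n : nat) (dO dX : measure_display)
  (Omega : measurableType dO) (Xi : measurableType dX) (P : probability Omega R).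
Variables (xi : {RV P >-> Xi})
    (f : Xi -> 'rV[R]_n -> R) (F : 'rV[R]_n -> R)
    (mu L N : R) (wstar winit : 'rV[R]_n)
    (D : nat) (Ss : Xi -> seq 'M[R]_n)
    (tau : nat -> nat) (eta : nat -> R)
    (xi_ : nat -> {RV P >-> Xi}) (u_ : nat -> {RV P >-> nat})
    (w_ what_ : nat -> Omega -> 'rV[R]_n)
    (Sigma : nat -> nat -> Omega -> 'M[R]_n).
Hypotheses (f_meas : forall w, measurable_fun setT (fun x => f x w))
    (f_diff : forall x w, differentiable (f x : 'rV[R]_n -> R^o) w)
    (gradF_mean : forall w i,
        has_mean P (fun o => grad (f (xi o)) w 0 i) (grad F w 0 i))
    (mu_gt0 : 0 < mu) (F_strong : strongly_convex mu F)
    (L_gt0 : 0 < L) (f_smooth : forall x, smooth L (f x))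
    (wstar_min : forall w, F wstar <= F w)
    (N_def : (N%:E = 2%:E *
        'E_P[fun o => (enorm (grad (f (xi o)) wstar) ^+ 2)%R])%E)
    (D_gt0 : (0 < D)%N)
    (Ss_filters : forall x, filters_of D (support_mx (f x)) (Ss x))
    (Ss_meas : forall u i k,
        measurable_fun setT (fun x => filter_mx (Ss x) u i k))
    (xi_law : forall t (B : set Xi), measurable B ->
        P (xi_ t @^-1` B) = P (xi @^-1` B))
    (u_law : forall t, cond_uniform P (xi_ t) (fun x => size (Ss x)) (u_ t))
    (Sigma_diag01 : forall t j o, in_window tau t j -> diag01 (Sigma t j o))
    (Sigma_meas : forall t j i k, in_window tau t j ->
        measurable_fun setT (fun o => Sigma t j o i k))
    (xi_u_indep : forall t,
        indep_of P (history tau (w_ 0%N) xi_ u_ Sigma t)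
          (fun o => (xi_ t o, u_ t o)))
    (w_init : forall o, w_ 0%N o = winit)
    (w_step : forall t o,
        w_ t.+1 o = w_ t o
          - (eta t * (size (Ss (xi_ t o)))%:R)
            *: (grad (f (xi_ t o)) (what_ t o)
                *m filter_mx (Ss (xi_ t o)) (u_ t o)))
    (what_read : forall t o,
        what_ t o = w_ (t - tau t)%N o
          - \sum_(t - tau t <= j < t)
              (eta j * (size (Ss (xi_ j o)))%:R)
              *: (grad (f (xi_ j o)) (what_ j o)
                  *m filter_mx (Ss (xi_ j o)) (u_ j o) *m Sigma t j o)).

Let G t := history tau (w_ 0%N) xi_ u_ Sigma t.
(** Omega carrying F_t as its sigma-algebra, so that being F_t-measurable is ordinary measurability
    on [HT t]. *)
Let HT t : measurableType (G t).-sigma := g_sigma_algebraType (G t).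
Let fg j o : 'rV[R]_n := filtered_grad f Ss (xi_ j o, u_ j o) (what_ j o).

Let salgG t : sigma_algebra setT (G t).
Proof. exact: smallest_sigma_algebra. Qed.

Let measHT t (A : set Omega) : (measurable (A : set (HT t))) = G t A.
Proof. by rewrite /HT measurable_g_measurableTypeE. Qed.

Lemma history_sub_measurable t : G t `<=` measurable.
Proof.
apply: smallest_sub; first exact: sigma_algebra_measurable.
move=> A [[|]|].
- move=> [i _ [B mB <-]].
  rewrite (_ : (fun o => w_ 0%N o 0 i) = fun=> winit 0 i).
    exact: measurable_cst.
  by apply/funext => o; rewrite w_init.
- by move=> [j /= _ [] [B mB <-]]; exact: measurable_funP.
- by move=> [s /= _ [j /= sj [[i k] _ [B mB <-]]]]; exact: Sigma_meas.
Qed.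

Lemma history_mono s t : (s <= t)%N -> G s `<=` G t.
Proof.
move=> st; apply: smallest_sub => //.
move=> A GA; apply: sub_sigma_algebra; case: GA => [[h|]|].
- by left; left.
- by move=> [j /= js h]; left; right; exists j => //=; exact: leq_trans st.
- by move=> [r /= rs h]; right; exists r => //=; exact: leq_trans st.
Qed.

Lemma history_measurable_fun s t (d' : measure_display) (Y : measurableType d')
  (X : Omega -> Y) : (s <= t)%N ->
  measurable_fun setT (X : HT s -> Y) -> measurable_fun setT (X : HT t -> Y).
Proof.
move=> st mX _ B mB; rewrite measHT; apply: (history_mono st).
by rewrite -measHT; exact: mX.
Qed.

Lemma history_sub_measurable_fun t (d' : measure_display) (Y : measurableType d')
  (X : Omega -> Y) : measurable_fun setT (X : HT t -> Y) -> measurable_fun setT X.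
Proof.
move=> mX _ B mB; apply: (@history_sub_measurable t).
by rewrite -measHT; exact: mX.
Qed.

Lemma history_w0 t i : measurable_fun setT (fun o : HT t => w_ 0%N o 0 i).
Proof.
rewrite (_ : (fun o => _) = fun=> winit 0 i); first exact: measurable_cst.
by apply/funext => o; rewrite w_init.
Qed.

Lemma history_xi t j : (j < t)%N -> measurable_fun setT (xi_ j : HT t -> Xi).
Proof.
move=> jt _ B mB; rewrite measHT; apply: sub_sigma_algebra.
by left; right; exists j => //; left; exists B.
Qed.

Lemma history_u t j : (j < t)%N -> measurable_fun setT (u_ j : HT t -> nat).
Proof.
move=> jt _ B mB; rewrite measHT; apply: sub_sigma_algebra.
by left; right; exists j => //; right; exists B.
Qed.

Lemma history_Sigma t j i k : in_window tau t j ->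
  measurable_fun setT (fun o : HT t => Sigma t j o i k).
Proof.
move=> tj _ B mB; rewrite measHT; apply: sub_sigma_algebra.
by right; exists t => //=; exists j => //; exists (i, k) => //; exists B.
Qed.

(** Gradients are measurable in the sample and Lipschitz in the point, so the Caratheodory lemma
    applies. [T] is left general for the use with [HT t]. *)
Lemma measurable_fun_filtered_grad (d' : measure_display) (T : measurableType d')
    (v : T -> 'rV[R]_n) i : (forall i, measurable_fun setT (fun o => v o 0 i)) ->
  measurable_fun setT (fun p : T * (Xi * nat) =>
    filtered_grad f Ss p.2 (v p.1) 0 i).
Proof.
move=> mv.
rewrite (_ : (fun p => _) = fun p : T * (Xi * nat) => (size (Ss p.2.1))%:R *
    filter_mx (Ss p.2.1) p.2.2 i i * grad (f p.2.1) (v p.1) 0 i); last first.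
  by apply/funext => p; rewrite (filtered_grad_coord Ss_filters).
have m21 : measurable_fun setT (fun p : T * (Xi * nat) => p.2.1).
  exact: measurableT_comp measurable_fst measurable_snd.
apply: measurable_funM; first apply: measurable_funM.
- exact: (measurableT_comp (measurable_fun_size_natr Ss_filters Ss_meas) m21).
- exact: (measurableT_comp (measurable_fun_joint_filter Ss_meas i i) measurable_snd).
have mc := measurable_fun_caratheodory
  (fun w => measurable_fun_grad i f_meas (fun x => f_diff x w))
  (fun x w w' => grad_coord_lipschitz f_smooth x w w' i) mv.
apply: (measurableT_comp mc (g := fun p : T * (Xi * nat) => (p.1, p.2.1))).
exact: measurable_fun_pair measurable_fst m21.
Qed.

Lemma history_filtered_grad t j : (j < t)%N ->
  (forall i, measurable_fun setT (fun o : HT j => what_ j o 0 i)) ->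
  forall i, measurable_fun setT (fun o : HT t => fg j o 0 i).
Proof.
move=> jt mw i.
have mw' k : measurable_fun setT (fun o : HT t => what_ j o 0 k).
  exact: (history_measurable_fun (ltnW jt) (mw k)).
apply: (measurableT_comp (measurable_fun_filtered_grad i mw')
  (g := fun o : HT t => (o, (xi_ j o, u_ j o)))).
apply: measurable_fun_pair => //; apply: measurable_fun_pair.
  exact: history_xi.
exact: history_u.
Qed.

Lemma w_stepE t o : w_ t.+1 o = w_ t o - eta t *: fg t o.
Proof. by rewrite w_step -scalerA. Qed.

Lemma what_readE t o : what_ t o = w_ (t - tau t)%N o
  - \sum_(t - tau t <= j < t) eta j *: (fg j o *m Sigma t j o).
Proof.
rewrite what_read; congr (_ - _); apply: eq_bigr => j _.
by rewrite -scalerA /fg /filtered_grad -scalemxAl.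
Qed.

(** Strong induction. The iterate is settled before the read, which may start from it; the read at t
    uses updates before t and the masks of read t, both in F_t. *)
Lemma history_iterates t :
  (forall i, measurable_fun setT (fun o : HT t => w_ t o 0 i)) /\
  (forall i, measurable_fun setT (fun o : HT t => what_ t o 0 i)).
Proof.
have [m tm] := ubnP t; elim: m t tm => // m IH t; rewrite ltnS => tm.
have mfg j : (j < t)%N -> forall i, measurable_fun setT (fun o : HT t => fg j o 0 i).
  by move=> jt; apply: history_filtered_grad => //; have [] := IH j (leq_trans jt tm).
have mw i : measurable_fun setT (fun o : HT t => w_ t o 0 i).
  case: t tm mfg => [|t] tm mfg; first exact: history_w0.
  rewrite (_ : (fun o => _) = fun o => w_ t o 0 i - eta t * fg t o 0 i); last first.
    by apply/funext => o; rewrite w_stepE !mxE.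
  apply: measurable_funB; last by apply: measurable_funM => //; exact: mfg.
  have [mw _] := IH t tm.
  exact: (history_measurable_fun (leqnSn t) (mw i)).
split=> // i.
(* Masks are diagonal and measurable only inside the window, so the summand is set to 0
   elsewhere. *)
rewrite (_ : (fun o => _) = fun o => w_ (t - tau t)%N o 0 i
  - \sum_(j <- index_iota (t - tau t) t) if in_window tau t j
      then eta j * (fg j o 0 i * Sigma t j o i i) else 0); last first.
  apply/funext => o; rewrite what_readE !mxE summxE; congr (_ - _).
  apply: eq_big_seq => j; rewrite mem_index_iota => tj.
  by rewrite mxE mul_diag01 /in_window ?tj//; exact: Sigma_diag01.
apply: measurable_funB.
  have [tau0|tau0] := posnP (tau t); first by rewrite tau0 subn0.
  have [t0|t0] := posnP t; first by rewrite t0 sub0n; exact: history_w0.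
  have lt : (t - tau t < t)%N by rewrite ltn_subrL t0 tau0.
  have [mw' _] := IH (t - tau t)%N (leq_trans lt tm).
  exact: (history_measurable_fun (ltnW lt) (mw' i)).
apply: (@measurable_sum _ (HT t)) => j.
have [tj|_] := boolP (in_window tau t j); last exact: measurable_cst.
apply: measurable_funM => //; apply: measurable_funM; last exact: history_Sigma.
by apply: mfg; have /andP[] := tj.
Qed.

(** * Squared errors of the process and their means *)

Let W t o := enorm (w_ t o - wstar) ^+ 2.
Let V t o := enorm (what_ t o - wstar) ^+ 2.
Let E t o := enorm (w_ t o - what_ t o) ^+ 2.
Let Q t o := enorm (fg t o) ^+ 2.

Lemma measurable_fun_enorm_sqr (d' : measure_display) (T : measurableType d')
    (v : T -> 'rV[R]_n) : (forall i, measurable_fun setT (fun o => v o 0 i)) ->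
  measurable_fun setT (fun o => enorm (v o) ^+ 2).
Proof.
move=> mv; under eq_fun do rewrite enorm_sqr_sum.
by apply: measurable_sum => i; exact: measurable_funX.
Qed.

Lemma history_W t : measurable_fun setT (W t : HT t -> R).
Proof.
have [mw _] := history_iterates t.
apply: (@measurable_fun_enorm_sqr _ (HT t)) => i; under eq_fun do rewrite mxE.
exact: measurable_funD.
Qed.

Lemma history_V t : measurable_fun setT (V t : HT t -> R).
Proof.
have [_ mw] := history_iterates t.
apply: (@measurable_fun_enorm_sqr _ (HT t)) => i; under eq_fun do rewrite mxE.
exact: measurable_funD.
Qed.

Lemma history_E t : measurable_fun setT (E t : HT t -> R).
Proof.
have [mw mv] := history_iterates t.
apply: (@measurable_fun_enorm_sqr _ (HT t)) => i; under eq_fun do rewrite !mxE.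
exact: measurable_funB.
Qed.

Lemma measurable_fun_Q t : measurable_fun setT (Q t).
Proof.
apply: measurable_fun_enorm_sqr => i; apply: (@history_sub_measurable_fun t.+1).
by apply: history_filtered_grad => //; have [] := history_iterates t.
Qed.

Lemma w_eq_window t o : w_ t o = w_ (t - tau t)%N o
  - \sum_(t - tau t <= j < t) eta j *: fg j o.
Proof.
suff aux m : (t - tau t <= m)%N -> w_ m o = w_ (t - tau t)%N o
    - \sum_(t - tau t <= j < m) eta j *: fg j o by apply: aux; exact: leq_subr.
elim: m => [|m IH]; first by rewrite leqn0 => /eqP ->; rewrite big_geq// subr0.
rewrite leq_eqVlt => /orP[/eqP <-|]; first by rewrite big_geq// subr0.
by rewrite ltnS => mt; rewrite w_stepE IH// big_nat_recr//= opprD addrA.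
Qed.

(** Unrolling the recursion over the window, iterate and read differ only through masks. The mask
    minus the identity has diagonal entries 0 or -1 and increases no coordinate; Cauchy-Schwarz over
    at most tau t terms gives the prefactor. *)
Lemma read_error_le t o : E t o <=
  (tau t)%:R * \sum_(t - tau t <= j < t) eta j ^+ 2 * Q j o.
Proof.
have -> : E t o = enorm (\sum_(j <- index_iota (t - tau t) t)
    eta j *: (fg j o *m Sigma t j o - fg j o)) ^+ 2.
  rewrite /E w_eq_window what_readE opprB addrC addrA subrK -sumrB.
  by congr (enorm _ ^+ 2); apply: eq_bigr => j _; rewrite scalerBr.
apply: (le_trans (enorm_sum_sqr_le _ _)); apply: ler_pM => //.
- by apply: sumr_ge0 => j _; exact: sqr_ge0.
- by rewrite size_iota ler_nat; lia.
rewrite big_seq [leRHS]big_seq; apply: ler_sum => j.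
rewrite mem_index_iota => tj; rewrite enormZ_sqr ler_wpM2l ?sqr_ge0// /Q.
rewrite !enorm_sqr_sum; apply: ler_sum => i _.
have d01 : diag01 (Sigma t j o) by exact: Sigma_diag01.
have -> : (fg j o *m Sigma t j o - fg j o) 0 i =
    fg j o 0 i * (Sigma t j o i i - 1).
  by rewrite mxE [X in _ + X]mxE (mul_diag01 _ _ d01) mulrBr mulr1.
rewrite exprMn ler_piMr ?sqr_ge0//.
by have [_ /(_ i)[->|->]] := d01; rewrite ?sub0r ?sqrrN ?subrr ?expr1n ?expr0n.
Qed.

Lemma history_integral_le t (H : Omega * (Xi * nat) -> R) (b : Omega -> R) m :
  measurable_fun setT (H : HT t * (Xi * nat) -> R) -> (forall p, 0 <= H p) ->
  has_mean P b m -> measurable_fun setT (b : HT t -> R) ->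
  (forall o, \int[P]_o' (H (o, (xi_ t o', u_ t o')))%:E <= (b o)%:E)%E ->
  (\int[P]_o (H (o, (xi_ t o, u_ t o)))%:E <= m%:E)%E.
Proof.
move=> mH H0 /has_meanE[_ <-] mb Hb.
apply: (freezing (salgG t) (@history_sub_measurable t)
  (z := fun o => (xi_ t o, u_ t o)) (H := EFin \o H) (b := EFin \o b)) => //.
- exact: measurable_fun_pair.
- exact/measurable_EFinP.
- exact/measurable_EFinP.
Qed.

(** Using [fine] allows these means to be named before integrability is known. *)
Let a t := fine (\int[P]_o (W t o)%:E).
Let ah t := fine (\int[P]_o (V t o)%:E).
Let b t := fine (\int[P]_o (E t o)%:E).
Let q t := fine (\int[P]_o (Q t o)%:E).

Lemma fg_second_moment t : has_mean P (V t) (ah t) ->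
  has_mean P (Q t) (q t) /\ q t <= D%:R * (2 * L ^+ 2 * ah t + N).
Proof.
move=> hV; apply: ge0_has_mean_le; first exact: measurable_fun_Q.
  by move=> o; exact: sqr_ge0.
have hb := has_meanZ D%:R (has_meanD (has_meanZ (2 * L ^+ 2) hV) (has_mean_cst P N)).
have [_ mwh] := history_iterates t.
apply: (@history_integral_le t (fun p => enorm (filtered_grad f Ss p.2 (what_ t p.1)) ^+ 2) _ _ _ _ hb).
- apply: (@measurable_fun_enorm_sqr _ (HT t * (Xi * nat))%type) => i.
  exact: measurable_fun_filtered_grad.
- by move=> p; exact: sqr_ge0.
- apply: measurable_funM => //; apply: measurable_funD => //.
  by apply: measurable_funM => //; exact: history_V.
move=> o; exact: (integral_filtered_grad_sqr f_meas f_diff gradF_mean L_gt0 f_smooth N_def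
  D_gt0 Ss_filters Ss_meas (@xi_law t) (@u_law t) (what_ t o)).
Qed.

(** Strong induction by domination: updates before t are square integrable by [fg_second_moment];
    they and the previous iterate control W t, the updates in the window control E t, and V t is at
    most 2 W t + 2 E t. *)
Lemma has_mean_errors t :
  [/\ has_mean P (W t) (a t), has_mean P (V t) (ah t) & has_mean P (E t) (b t)].
Proof.
have [m tm] := ubnP t; elim: m t tm => // m IH t; rewrite ltnS => tm.
have hQ j : (j < t)%N -> has_mean P (Q j) (q j).
  move=> jt; have [_ hV _] := IH j (leq_trans jt tm).
  by have [] := fg_second_moment hV.
have mW := history_sub_measurable_fun (@history_W t).
have mV := history_sub_measurable_fun (@history_V t).
have mE := history_sub_measurable_fun (@history_E t).
have hW : has_mean P (W t) (a t).
  case: t tm hQ mW {mV mE} => [|t] tm hQ mW.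
    apply: has_mean_dominated mW _ (has_mean_cst P (enorm (winit - wstar) ^+ 2)) => o.
    by rewrite sqr_ge0/= /W w_init.
  have [hW _ _] := IH t tm.
  have h := has_meanD (has_meanZ 2 hW) (has_meanZ 2 (has_meanZ (eta t ^+ 2) (hQ t (ltnSn t)))).
  apply: has_mean_dominated mW _ h => o; rewrite sqr_ge0/= /W w_stepE addrAC.
  by apply: (le_trans (enormD_sqr_le _ _)); rewrite enormN enormZ_sqr.
have hE : has_mean P (E t) (b t).
  have hS : has_mean P (fun o => \sum_(t - tau t <= j < t) eta j ^+ 2 * Q j o)
      (\sum_(t - tau t <= j < t) eta j ^+ 2 * q j).
    apply: has_mean_sum => j; rewrite mem_index_iota => /andP[_ jt].
    exact: has_meanZ (hQ j jt).
  apply: has_mean_dominated mE _ (has_meanZ (tau t)%:R hS) => o.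
  by rewrite sqr_ge0/=; exact: read_error_le.
split => //.
apply: has_mean_dominated mV _ (has_meanD (has_meanZ 2 hW) (has_meanZ 2 hE)) => o.
rewrite sqr_ge0/= /V -[what_ t o](subrK (w_ t o)) -addrA addrC.
by apply: (le_trans (enormD_sqr_le _ _)); rewrite -[what_ t o - _]opprB enormN.
Qed.

Lemma read_error_mean_le t : b t <= (tau t)%:R *
  \sum_(t - tau t <= j < t) eta j ^+ 2 * (2 * L ^+ 2 * D%:R * ah j + D%:R * N).
Proof.
have hQ j : has_mean P (Q j) (q j) /\ q j <= D%:R * (2 * L ^+ 2 * ah j + N).
  by have [_ hV _] := has_mean_errors j; exact: fg_second_moment.
have [_ _ hE] := has_mean_errors t.
have h := has_meanZ (tau t)%:R (has_mean_sum (s := index_iota (t - tau t) t)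
  (F := fun j o => eta j ^+ 2 * Q j o) (fun j _ => has_meanZ (eta j ^+ 2) (hQ j).1)).
apply: (le_trans (has_mean_le hE h (read_error_le t))).
rewrite ler_wpM2l//; apply: ler_sum => j _; rewrite ler_wpM2l ?sqr_ge0//.
by apply: (le_trans (hQ j).2); rewrite mulrDr mulrA mulrC [D%:R * _]mulrC mulrC.
Qed.

Lemma read_mean_le t : ah t <= 2 * a t + 2 * b t.
Proof.
have [hW hV hE] := has_mean_errors t.
apply: has_mean_le hV (has_meanD (has_meanZ 2 hW) (has_meanZ 2 hE)) _ => o.
rewrite /V -[what_ t o](subrK (w_ t o)) -addrA addrC.
by apply: (le_trans (enormD_sqr_le _ _)); rewrite -[what_ t o - _]opprB enormN.
Qed.

Lemma iterate_mean_rec t : 0 <= eta t -> mu * eta t <= 2 ->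
  4 * D%:R * L ^+ 2 * eta t <= mu ->
  a t.+1 <= (1 - mu * eta t / 2) * a t
    + eta t * (mu + 2 * (n%:R + 1) * L ^+ 2 / mu) * b t + eta t ^+ 2 * (D%:R * N).
Proof.
move=> eta0 eta2 etaL.
have [hW hV hE] := has_mean_errors t.
have hb := has_meanD (has_meanD (has_meanZ (1 - mu * eta t / 2) hW)
  (has_meanZ (eta t * (mu + 2 * (n%:R + 1) * L ^+ 2 / mu)) hE))
  (has_mean_cst P (eta t ^+ 2 * (D%:R * N))).
have [hW1 _ _] := has_mean_errors t.+1; have /has_meanE[_ aE] := hW1.
rewrite -lee_fin -aE.
under eq_integral do rewrite /W w_stepE addrAC.
have [mw mwh] := history_iterates t.
apply: (@history_integral_le t (fun p => enorm (w_ t p.1 - wstar -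
  eta t *: filtered_grad f Ss p.2 (what_ t p.1)) ^+ 2) _ _ _ _ hb).
- apply: (@measurable_fun_enorm_sqr _ (HT t * (Xi * nat))%type) => i.
  rewrite (_ : (fun p => _) = fun p : HT t * (Xi * nat) =>
    (w_ t p.1 0 i - wstar 0 i) - eta t * filtered_grad f Ss p.2 (what_ t p.1) 0 i); last first.
    by apply/funext => p; rewrite !mxE.
  apply: measurable_funB.
    apply: measurable_funB => //; exact: measurableT_comp (mw i) measurable_fst.
  by apply: measurable_funM => //; exact: measurable_fun_filtered_grad.
- by move=> p; exact: sqr_ge0.
- apply: measurable_funD => //; apply: measurable_funD; apply: measurable_funM => //.
    exact: history_W.
  exact: history_E.
move=> o.
have := integral_sgd_step f_meas f_diff gradF_mean mu_gt0 F_strong L_gt0 f_smooth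
  wstar_min N_def D_gt0 Ss_filters Ss_meas (@xi_law t) (@u_law t)
  (what_ t o) (w_ t o - wstar) eta0 etaL.
by rewrite opprB addrA subrK.
Qed.

(** The interface between probability and analysis: from here on only real sequences and their
    inequalities matter, in the format of the deterministic recursion. *)
Lemma hogwild_moments : exists a ah b : nat -> R,
  [/\ forall t, 0 <= a t /\ 0 <= ah t,
      forall t, ('E_P[fun o => (enorm (w_ t o - wstar) ^+ 2)%R] = (a t)%:E)%E,
      forall t, ('E_P[fun o => (enorm (what_ t o - wstar) ^+ 2)%R] = (ah t)%:E)%E,
      forall t, ah t <= 2 * a t + 2 * b t &
      (forall t, b t <= (tau t)%:R *
         \sum_(t - tau t <= j < t) eta j ^+ 2 * (2 * L ^+ 2 * D%:R * ah j + D%:R * N))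
      /\
      (forall t, 0 <= eta t -> mu * eta t <= 2 -> 4 * D%:R * L ^+ 2 * eta t <= mu ->
         a t.+1 <= (1 - mu * eta t / 2) * a t
           + eta t * (mu + 2 * (n%:R + 1) * L ^+ 2 / mu) * b t
           + eta t ^+ 2 * (D%:R * N))].
Proof.
exists a, ah, b; split.
- move=> t; have [hW hV _] := has_mean_errors t.
  by split; [apply: has_mean_le (has_mean_cst P 0) hW _ |
             apply: has_mean_le (has_mean_cst P 0) hV _] => o; exact: sqr_ge0.
- by move=> t; have [[]] := has_mean_errors t.
- by move=> t; have [_ []] := has_mean_errors t.
- exact: read_mean_le.
- split; [exact: read_error_mean_le|exact: iterate_mean_rec].
Qed.

End hogwild.

(** * The rate, from the moment inequalities and the deterministic recursion *)

Theorem lemma12 (R : realType) (n : nat)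
    (dO dX : measure_display) (Omega : measurableType dO)
    (Xi : measurableType dX) (P : probability Omega R)
    (xi : {RV P >-> Xi})
    (f : Xi -> 'rV[R]_n -> R) (F : 'rV[R]_n -> R)
    (mu L alpha N : R) (wstar winit : 'rV[R]_n)
    (D : nat) (Ss : Xi -> seq 'M[R]_n)
    (tau : nat -> nat) (alpha_ eta : nat -> R)
    (xi_ : nat -> {RV P >-> Xi}) (u_ : nat -> {RV P >-> nat})
    (w_ what_ : nat -> Omega -> 'rV[R]_n)
    (Sigma : nat -> nat -> Omega -> 'M[R]_n)
    (* the objective *)
    (f_meas : forall w, measurable_fun setT (fun x => f x w))
    (f_diff : forall x w, differentiable (f x : 'rV[R]_n -> R^o) w)
    (F_diff : forall w, differentiable (F : 'rV[R]_n -> R^o) w)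
    (F_mean : forall w, has_mean P (fun o => f (xi o) w) (F w))
    (gradF_mean : forall w i,
        has_mean P (fun o => grad (f (xi o)) w 0 i) (grad F w 0 i))
    (mu_gt0 : 0 < mu) (F_strong : strongly_convex mu F)
    (L_gt0 : 0 < L) (f_smooth : forall x, smooth L (f x))
    (f_convex : forall x, convex_grad (f x))
    (wstar_min : forall w, F wstar <= F w)
    (N_def : (N%:E = 2%:E *
        'E_P[fun o => (enorm (grad (f (xi o)) wstar) ^+ 2)%R])%E)
    (* the filters *)
    (D_gt0 : (0 < D)%N)
    (Ss_filters : forall x, filters_of D (support_mx (f x)) (Ss x))
    (Ss_meas : forall u i k,
        measurable_fun setT (fun x => filter_mx (Ss x) u i k))
    (* the randomness; mutual independence of the xi_ t is part of xi_u_indep *)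
    (xi_law : forall t (B : set Xi), measurable B ->
        P (xi_ t @^-1` B) = P (xi @^-1` B))
    (u_law : forall t, cond_uniform P (xi_ t) (fun x => size (Ss x)) (u_ t))
    (Sigma_diag01 : forall t j o, in_window tau t j -> diag01 (Sigma t j o))
    (Sigma_meas : forall t j i k, in_window tau t j ->
        measurable_fun setT (fun o => Sigma t j o i k))
    (xi_u_indep : forall t,
        indep_of P (history tau (w_ 0%N) xi_ u_ Sigma t)
          (fun o => (xi_ t o, u_ t o)))
    (* the recursion and the consistent reads *)
    (w_init : forall o, w_ 0%N o = winit)
    (w_step : forall t o,
        w_ t.+1 o = w_ t o
          - (eta t * (size (Ss (xi_ t o)))%:R)
            *: (grad (f (xi_ t o)) (what_ t o)
                *m filter_mx (Ss (xi_ t o)) (u_ t o)))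
    (what_read : forall t o,
        what_ t o = w_ (t - tau t)%N o
          - \sum_(t - tau t <= j < t)
              (eta j * (size (Ss (xi_ j o)))%:R)
              *: (grad (f (xi_ j o)) (what_ j o)
                  *m filter_mx (Ss (xi_ j o)) (u_ j o) *m Sigma t j o))
    (* delays and step sizes *)
    (tau_mono : forall s t, (s <= t)%N -> (tau s <= tau t)%N)
    (tau_ge : forall t, 2 * L * alpha * D%:R / mu <= (tau t)%:R)
    (tau_le : \forall t \near \oo,
        (tau t)%:R <=
          Num.sqrt (t%:R * ((ln t%:R)^-1 - (ln t%:R ^+ 2)^-1)) :> R)
    (alpha_bounds : forall t, 12 <= alpha_ t <= alpha)
    (eta_def : forall t,
        eta t = alpha_ t / (mu * (t%:R + 2 * (tau t)%:R))) :
  (exists2 h : nat -> R^o,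
     h =O_\oo (fun t => (t%:R * ln t%:R)^-1 : R^o) &
     \forall t \near \oo,
       ('E_P[fun o => (enorm (what_ t.+1 o - wstar) ^+ 2)%R] <=
        (4 * alpha ^+ 2 * D%:R * N / mu ^+ 2 * t%:R^-1 + h t)%:E)%E) /\
  (exists2 h : nat -> R^o,
     h =O_\oo (fun t => (t%:R * ln t%:R)^-1 : R^o) &
     \forall t \near \oo,
       ('E_P[fun o => (enorm (w_ t.+1 o - wstar) ^+ 2)%R] <=
        (4 * alpha ^+ 2 * D%:R * N / mu ^+ 2 * t%:R^-1 + h t)%:E)%E).
Proof.
have [a [ah [b [ge0 aE ahE ah_le [b_le a_rec]]]]] := hogwild_moments f_meas f_diff
  gradF_mean mu_gt0 F_strong L_gt0 f_smooth wstar_min N_def D_gt0 Ss_filters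
  Ss_meas xi_law u_law Sigma_diag01 Sigma_meas xi_u_indep w_init w_step what_read.
have N0 : 0 <= N.
  exact: noise_ge0 f_meas f_diff N_def.
have V0 : 0 <= D%:R * N by rewrite mulr_ge0.
have L2 : 0 < L ^+ 2 by rewrite exprn_gt0.
have D0 : 0 < D%:R :> R by rewrite ltr0n.
(* The two smallness conditions on the step under which the recursion for [a] holds. *)
pose e0 := Num.min (2 / mu) (mu / (4 * D%:R * L ^+ 2)).
have e00 : 0 < e0 by rewrite lt_min !divr_gt0// !mulr_gt0.
have eta0 : forall t, 0 <= eta t := step_ge0 mu_gt0 alpha_bounds eta_def.
have a_rec' t : eta t <= e0 -> a t.+1 <= (1 - mu * eta t / 2) * a t
    + eta t * (mu + 2 * (n%:R + 1) * L ^+ 2 / mu) * b t + eta t ^+ 2 * (D%:R * N).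
  rewrite le_min => /andP[]; rewrite !ler_pdivlMr ?mulr_gt0// => h1 h2.
  by apply: a_rec => //; rewrite mulrC.
have K1 : 0 <= mu + 2 * (n%:R + 1) * L ^+ 2 / mu.
  apply: addr_ge0; first exact: ltW.
  apply: divr_ge0; last exact: ltW.
  by rewrite mulr_ge0 ?mulr_ge0 ?addr_ge0// ltW.
have K2 : 0 <= 2 * L ^+ 2 * D%:R by rewrite mulr_ge0 ?mulr_ge0// ltW.
have [K K0 rate] := delayed_recursion_rate mu_gt0 tau_le alpha_bounds eta_def
  K1 K2 V0 e00 (fun t => (ge0 t).1) (fun t => (ge0 t).2) a_rec' b_le ah_le.
pose C := alpha ^+ 2 * (D%:R * N) / mu ^+ 2.
have C0 : 0 <= C by apply: divr_ge0; [apply: mulr_ge0 => //|]; exact: sqr_ge0.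
(* The bounds at t + 1 are weakened to the scales at t, as both scales decrease. *)
have rateS : \forall t \near \oo, [/\ 0 < tlnt R t,
    a t.+1 <= C * t%:R^-1 + K * tlnt R t & b t.+1 <= K * tlnt R t].
  have := filterI (near_delay tau_le) rate => -[T _ HT].
  exists T.+1 => // t /= Tt; have [[l1 _ _] _] := HT t (ltnW Tt).
  have [_ [aS bS]] := HT t.+1 (leqW (ltnW Tt)).
  have t0 : (0 < t)%N by exact: leq_trans Tt.
  have T0 : 0 < t%:R :> R by rewrite ltr0n.
  have le_t : t%:R <= t.+1%:R :> R by rewrite ler_nat.
  have l0 : 0 < ln (t%:R : R) by lra.
  have T0' : 0 < t.+1%:R :> R by [].
  have le_l : ln (t%:R : R) <= ln (t.+1%:R : R) by rewrite ler_ln ?posrE.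
  have dec : tlnt R t.+1 <= tlnt R t.
    rewrite /tlnt lef_pV2 ?posrE ?mulr_gt0//; last by lra.
    by apply: ler_pM => //; exact: ltW.
  have Kdec : K * tlnt R t.+1 <= K * tlnt R t by rewrite ler_wpM2l.
  split; first by rewrite invr_gt0 mulr_gt0.
    apply: (le_trans aS); apply: lerD => //.
    by rewrite ler_wpM2l// lef_pV2 ?posrE.
  exact: le_trans Kdec.
(* The coefficient 4 K comes from ah <= 2 a + 2 b with K [tlnt] in each of a and b; the same
   remainder serves the iterates. The [+ 1] in the witness makes it positive even if K = 0. *)
have bigO : (fun t => 4 * K * tlnt R t : R^o) =O_\oo (fun t => (t%:R * ln t%:R)^-1 : R^o).
  apply/eqO_exP; exists (4 * K + 1); first by rewrite ltr_wpDl ?mulr_ge0.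
  by apply: nearW => t; rewrite normrM ger0_norm ?mulr_ge0// ler_wpM2r// lerDl.
split; exists (fun t => 4 * K * tlnt R t) => //; apply: filterS rateS => t [p0 aS bS].
all: have Ct : 0 <= C * t%:R^-1 by rewrite mulr_ge0// invr_ge0.
all: have Kt : 0 <= K * tlnt R t by rewrite mulr_ge0// ltW.
all: have -> : 4 * alpha ^+ 2 * D%:R * N / mu ^+ 2 * t%:R^-1 = 4 * (C * t%:R^-1)
  by rewrite /C !mulrA.
all: rewrite ?ahE ?aE lee_fin -mulrA.
- have := ah_le t.+1; lra.
- lra.
Qed.
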